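(* Let $0<\alpha_0<r$ be fixed, let $0<\alpha\le\alpha_0$ and let $\hat s^{(ht)}_{\tilde m}$ be the model selection estimator associated with the model collections $\mathcal{M}^{(h)}_n$ and the penalty $\widetilde{\mathrm{pen}}_n$. Assume that $(\lambda_n)_n$ is a non-decreasing sequence of positive numbers with $\lim_{n\to+\infty}n^{-1}\lambda_n=0$, and that there exist $n_0\in\mathbb{N}^*$, $0<\delta\le\frac12$, $0<p<1$ and $\kappa>1$ such that $\lambda_{2n}\le2(1-\delta)\lambda_n$ for every $n\ge n_0$, $\lambda_{n_0}\ge\Upsilon(\delta,p,\alpha_0)$, and for every $n$ $$\sum_{m\in\mathcal{M}^{(h)}_n}e^{-\frac{(\sqrt{\kappa^{-1}\lambda_n}-1)^2D_m}{2}}\le\sqrt{1-p}.$$ Then $$MS\left(\hat s^{(ht)}_{\tilde m},\rho_\alpha\right):=:\mathcal{B}^{\frac{\alpha}{1+2\alpha}}_{2,\infty}\cap\mathcal{A}^\alpha_{\mathcal{M}^{(h)}}.$$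
   Context: Gaussian white noise model on $[0,1]$: $s\in\mathbb{L}_2([0,1])$ is unknown, $\|\cdot\|$ is the $\mathbb{L}_2([0,1])$ norm, and for $n\in\mathbb{N}^*=\{1,2,\dots\}$ one observes, for all $u\in\mathbb{L}_2([0,1])$, $Y_n(u)=\int_0^1u(t)s(t)\,dt+\frac{1}{\sqrt n}W_u$, where $(W_u)$ is a centered Gaussian process with $\mathbb{E}[W_uW_{u'}]=\int_0^1u(t)u'(t)\,dt$. Wavelets: $\phi,\psi$ are a compactly supported scaling function and wavelet whose dilates/translates $\phi_{jk}(x)=2^{j/2}\phi(2^jx-k)$, $\psi_{jk}(x)=2^{j/2}\psi(2^jx-k)$, once periodized, give an orthonormal basis $\Psi=\{\phi_{00},\psi_{jk}:j\ge0,\ 0\le k\le2^j-1\}$ of $\mathbb{L}_2([0,1])$; the associated multiresolution analysis is $r$-regular (in the sense of Meyer) with $r\ge1$. Write $s=\alpha_{00}\phi_{00}+\sum_{j\ge0}\sum_{k=0}^{2^j-1}\beta_{jk}\psi_{jk}$. Models: fix $\theta>2$. For $J\in\mathbb{N}=\{0,1,\dots\}$, $\mathcal{P}_J(\mathcal{I})$ is the set of all subsets $\mathcal{I}_m$ of $\mathcal{I}=\{(j,k):j\ge0,0\le k\le2^j-1\}$ of the form $\mathcal{I}_m=\{(j,k):0\le j<J,0\le k<2^j\}\cup\bigcup_{j\ge J}\{(j,k):k\in A_j\}$ with $|A_j|=\lfloor2^J(j-J+1)^{-\theta}\rfloor$, where $\lfloor x\rfloor=\max\{n\in\mathbb{N}:n\le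 x\}$. $\mathcal{M}^{(h)}=\{\mathrm{span}\{\phi_{00},\psi_{jk}:(j,k)\in\mathcal{I}_m\}:J\in\mathbb{N},\mathcal{I}_m\in\mathcal{P}_J(\mathcal{I})\}$; all its models built from $\mathcal{P}_J(\mathcal{I})$ have the same dimension, denoted $D_J$. The maximal resolution level $j_0(n)$, non-decreasing in $n$, is given by $2^{j_0(n)}\le n\lambda_n^{-1}<2^{j_0(n)+1}$, and $\mathcal{M}^{(h)}_n=\{\mathrm{span}\{\phi_{00},\psi_{jk}:(j,k)\in\mathcal{I}_m,\ j<j_0(n)\}:J\in\mathbb{N},\mathcal{I}_m\in\mathcal{P}_J(\mathcal{I})\}$. $D_m$ is the dimension of $m$, $s_m$ the orthogonal projection of $s$ onto $m$. Estimator: $\hat s_m$ minimizes $\gamma_n(u)=-2Y_n(u)+\|u\|^2$ over $u\in m$. For $m\in\mathcal{M}^{(h)}_n$ obtained from an index set in $\mathcal{P}_J(\mathcal{I})$, $\widetilde{\mathrm{pen}}_n(m)=\frac{\lambda_n}{n}D_J$ (the smallest possible $D_J$ if several $J$ give the same $m$). $\hat s^{(ht)}_{\tilde m}=\hat s_{\tilde m}$ with $\tilde m=\arg\min_{m\in\mathcal{M}^{(h)}_n}\{\gamma_n(\hat s_m)+\widetilde{\mathrm{pen}}_n(m)\}$. Notation: $\rho_\alpha=(\rho_{n,\alpha})_n$, $\rho_{n,\alpha}=\left(\frac{\lambda_n}{n}\right)^{\frac{\alpha}{1+2\alpha}}$; $g(\delta,\alpha_0)=(1-\delta)^{\frac{2\alpha_0}{2\alpha_0+1}}-1+\delta$;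 $\Upsilon(\delta,p,\alpha_0)=\frac{8}{p\,g(\delta,\alpha_0)}\left(\frac{16}{g(\delta,\alpha_0)}+1\right)$. Function spaces: $\mathcal{B}^{\frac{\alpha}{1+2\alpha}}_{2,\infty}=\{s\in\mathbb{L}_2([0,1]):\sup_{J\in\mathbb{N}}2^{\frac{2J\alpha}{1+2\alpha}}\sum_{j\ge J}\sum_{k=0}^{2^j-1}\beta_{jk}^2<\infty\}$; $\mathcal{A}^\alpha_{\mathcal{M}^{(h)}}=\{s\in\mathbb{L}_2([0,1]):\sup_{M>0}\{M^\alpha\inf_{\{m\in\mathcal{M}^{(h)}:D_m\le M\}}\|s_m-s\|\}<\infty\}$ (supremum over those $M$ for which some model has dimension at most $M$). Balls are given by bounding these suprema by the radius; the ball of an intersection is the intersection of the balls. Maxisets: for an estimator $\hat s$, $MS(\hat s,\rho_\alpha)=\{s\in\mathbb{L}_2([0,1]):\sup_n\{\rho_{n,\alpha}^{-2}\mathbb{E}[\|\hat s-s\|^2]\}<\infty\}$, and its ball $MS(\hat s,\rho_\alpha)(R)$ is the set of $s$ for which this supremum is $\le R^2$. $MS(\hat s,\rho_\alpha):=:\mathcal{F}$ means: for every $R>0$ there is $R'>0$ with $MS(\hat s,\rho_\alpha)(R)\subset\mathcal{F}(R')$, and for every $R'>0$ there is $R>0$ with $\mathcal{F}(R')\subset MS(\hat s,\rho_\alpha)(R)$.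
   Formalization: The formal version also assumes λ_1 > 1/2 (i.e. j_0(1) ≤ 0); if λ_1 ≤ 1/2, every model contains ψ_00, so Aψ_00 lies in one fixed maxiset ball for all real A while its Besov norm is unbounded, and the claimed uniform inclusion of balls fails. *)

(* Defs.v *)
From HB Require Import structures.
From mathcomp Require Import all_boot all_order all_algebra.
From mathcomp Require Import all_classical all_reals all_analysis.
Set Implicit Arguments.
Unset Strict Implicit.
Unset Printing Implicit Defensive.
Import Order.TTheory GRing.Theory Num.Theory.
Import numFieldNormedType.Exports.
Local Open Scope classical_set_scope.
Local Open Scope ring_scope.

Section L2.
Context {R : realType} (mu : {measure set (measurableTypeR R) -> \bar R}).

(* Elements of L2(mu) are handled through representatives R -> R: lspan
   consists of pointwise linear combinations of the given representatives,
   whereas closed_lspan is closed under mu-a.e. equality. *)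
Definition L2 : set (R -> R) := [set f | f \in Lfun mu 2%:E].

(* ip and nrm are only meaningful on L2. *)
Definition ip (u v : R -> R) : R := \int[mu]_x (u x * v x).

Definition nrm (u : R -> R) : R := fine 'N[mu]_2%:E[EFin \o u]%E.

Definition lspan (E : set (R -> R)) : set (R -> R) :=
  [set f | exists (n : nat) (a : 'I_n -> R) (e : 'I_n -> R -> R),
     (forall i, E (e i)) /\ f = (fun x => \sum_(i < n) a i * e i x)].

Definition closed_lspan (E : set (R -> R)) : set (R -> R) :=
  [set f | L2 f /\ forall eps : R, 0 < eps ->
     exists2 g, lspan E g & ('N[mu]_2%:E[EFin \o (f \- g)%R] < eps%:E)%E].

Definition orthonormal_basis (I : eqType) (D : set I) (e : I -> R -> R)
    (V : set (R -> R)) : Prop :=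
  [/\ forall i, D i -> L2 (e i),
      forall i j, D i -> D j -> ip (e i) (e j) = (i == j)%:R
    & closed_lspan (e @` D) = V].

Definition has_dim (V : set (R -> R)) (d : nat) : Prop :=
  exists e : 'I_d -> R -> R,
    [/\ forall i, L2 (e i),
        forall a : 'I_d -> R,
          ('N[mu]_2%:E[EFin \o (fun x => \sum_i a i * e i x)%R] = 0)%E ->
          forall i, a i = 0
      & lspan (range e) = V].

Definition l2dim (V : set (R -> R)) : nat := xget 0%N [set d | has_dim V d].

Definition oproj (V : set (R -> R)) (s : R -> R) : R -> R :=
  xget (fun=> 0) [set v | V v /\ forall u, V u -> ip (s \- v) u = 0].

End L2.

Section Wavelets.
Context {R : realType}.
Implicit Types (f g phi psi : R -> R) (V : int -> set (R -> R)).

Local Notation leb := (@lebesgue_measure R).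

Definition dil f (j k : int) : R -> R :=
  fun x => 2 `^ (j%:~R / 2) * f (2 ^ j * x - k%:~R).

Definition compactly_supported f : Prop :=
  exists M : R, forall x, M < `|x| -> f x = 0.

Definition riesz_shifts g (V0 : set (R -> R)) : Prop :=
  [/\ L2 leb g, closed_lspan leb (range (dil g 0)) = V0
    & exists c C : R, 0 < c /\
        forall (n : nat) (k0 : int) (a : 'I_n -> R),
          c * (\sum_i a i ^+ 2) <=
            nrm leb (fun x => \sum_i a i * dil g 0 (k0 + i%:Z) x) ^+ 2 <=
          C * (\sum_i a i ^+ 2)].

Record multiresolution V : Prop := {
  mra_closed : forall j, closed_lspan leb (V j) = V j ;
  mra_incr : forall j, V j `<=` V (j + 1) ;
  mra_inter : forall f, (forall j, V j f) -> ('N[leb]_2%:E[EFin \o f] = 0)%E ;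
  mra_dense : closed_lspan leb (\bigcup_j V j) = L2 leb ;
  mra_scale : forall j f, V j f <-> V (j + 1) (fun x => f (2 * x)) ;
  mra_shift : forall (k : int) f, V 0 f <-> V 0 (fun x => f (x - k%:~R)) ;
  mra_riesz : exists g, riesz_shifts g (V 0)
}.

(* Distributional derivatives up to order r, all with fast decay: D i.+1 is a
   locally integrable derivative of D i in the sense of the fundamental
   theorem of calculus (this covers functions of class C^r as well as splines
   of degree r). *)
Definition regular_function (r : nat) g : Prop :=
  exists D : nat -> R -> R,
    [/\ D 0%N = g,
        forall i, (i < r)%N -> forall x y : R, x <= y ->
          D i y - D i x = \int[leb]_(t in `[x, y]) D i.+1 t
      & forall i, (i <= r)%N ->
          measurable_fun setT (D i) /\
          forall m : nat, exists C : R,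
            {ae leb, forall x, `|D i x| <= C * ((1 + `|x|) ^+ m)^-1}].

Definition regular_multiresolution (r : nat) V : Prop :=
  multiresolution V /\ exists g, riesz_shifts g (V 0) /\ regular_function r g.

Definition mra_of phi : int -> set (R -> R) :=
  fun j => closed_lspan leb (range (dil phi j)).

Definition scaling_function phi : Prop :=
  multiresolution (mra_of phi) /\
  orthonormal_basis leb [set: int] (dil phi 0) (mra_of phi 0).

Definition wavelet phi psi : Prop :=
  orthonormal_basis leb [set: int] (dil psi 0)
    [set f | mra_of phi 1 f /\ forall g, mra_of phi 0 g -> ip leb f g = 0].

(* The sum over int is a finitely supported one when f is compactly
   supported. *)
Definition periodize f : R -> R := fun x => \sum_(l \in [set: int]) f (x + l%:~R).

Definition leb01 : {measure set (measurableTypeR R) -> \bar R} :=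
  mrestr leb (measurable_itv `[0 : R, 1]).

(* None stands for phi_00 and Some (j, k) for psi_jk, both periodized. *)
Definition Psi phi psi (i : option (nat * nat)) : R -> R :=
  match i with
  | None => periodize (dil phi 0 0)
  | Some (j, k) => periodize (dil psi j%:Z k%:Z)
  end.

Definition wavelet_indices : set (nat * nat) :=
  [set jk | (jk.2 < 2 ^ jk.1)%N].

Definition Psi_indices : set (option (nat * nat)) :=
  None |` (Some @` wavelet_indices).

Definition wavelet_setting (r : nat) phi psi : Prop :=
  [/\ compactly_supported phi /\ compactly_supported psi,
      scaling_function phi /\ wavelet phi psi,
      regular_multiresolution r (mra_of phi)
    & orthonormal_basis leb01 Psi_indices (Psi phi psi) (L2 leb01)].

End Wavelets.

Section Models.
Context {R : realType} (phi psi : R -> R) (theta : R).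
Local Notation mu := (@leb01 R).

Definition coef (s : R -> R) (j k : nat) : R :=
  ip mu s (Psi phi psi (Some (j, k))).

Definition index_sets (J : nat) : set (set (nat * nat)) :=
  [set I | exists A : nat -> set nat,
     (forall j, (J <= j)%N -> A j `<=` `I_(2 ^ j) /\
        (A j #= `I_(Num.truncn (2 ^+ J * (j - J).+1%:R `^ (- theta))))%card) /\
     I = [set jk | (jk.1 < J)%N /\ (jk.2 < 2 ^ jk.1)%N] `|`
         [set jk | (J <= jk.1)%N /\ A jk.1 jk.2]].

Definition model_of (I : set (nat * nat)) : set (R -> R) :=
  lspan (Psi phi psi @` (None |` (Some @` I))).

Definition models : set (set (R -> R)) :=
  [set m | exists J I, index_sets J I /\ m = model_of I].

(* All the models built from index_sets J have this same dimension D_J. *)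
Definition dimJ (J : nat) : nat :=
  xget 0%N [set d | exists2 I, index_sets J I & d = l2dim mu (model_of I)].

Definition truncate (j0 : int) (I : set (nat * nat)) : set (nat * nat) :=
  [set jk | I jk /\ jk.1%:Z < j0].

Definition models_upto_from (j0 : int) (J : nat) : set (set (R -> R)) :=
  [set m | exists2 I, index_sets J I & m = model_of (truncate j0 I)].

Definition models_upto (j0 : int) : set (set (R -> R)) :=
  [set m | exists J, models_upto_from j0 J m].

(* The infimum is the smallest dimJ J among the J giving rise to m. *)
Definition penalty (lambda : nat -> R) (j0 : nat -> int) (n : nat)
    (m : set (R -> R)) : R :=
  lambda n / n%:R *
  inf [set (dimJ J)%:R | J in [set J | models_upto_from (j0 n) J m]].

Definition besov_ball (alpha rad : R) : set (R -> R) :=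
  [set s | L2 mu s /\
    (ereal_sup
       [set (2 `^ (2 * J%:R * alpha / (1 + 2 * alpha)))%:E *
            \sum_(J <= j <oo) (\sum_(k < 2 ^ j) coef s j k ^+ 2)%:E
       | J in [set: nat]] <= rad%:E)%E].

Definition approx_ball (alpha rad : R) : set (R -> R) :=
  [set s | L2 mu s /\
    (ereal_sup
       [set (M `^ alpha)%:E *
            ereal_inf [set (nrm mu (oproj mu m s \- s))%:E
                      | m in [set m | models m /\ ((l2dim mu m)%:R <= M)%R]]
       | M in [set M : R | (0 < M)%R /\
                 exists2 m, models m & ((l2dim mu m)%:R <= M)%R]] <= rad%:E)%E].

End Models.

Section WhiteNoise.
Context {R : realType} (d : measure_display) (T : measurableType d)
  (P : probability T R).
Local Notation mu := (@leb01 R).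

(* Degenerate Gaussian laws are Dirac masses; normal_prob uses another
   convention for a null standard deviation. *)
Definition gaussian_law (m sigma : R) (A : set (measurableTypeR R)) : \bar R :=
  if sigma == 0 then dirac m A else normal_prob m sigma A.

Definition gaussian (Z : T -> R) : Prop :=
  exists m sigma : R, forall A : set (measurableTypeR R), measurable A ->
    P (Z @^-1` A) = gaussian_law m sigma A.

Definition white_noise (W : (R -> R) -> {RV P >-> R}) : Prop :=
  [/\ forall (n : nat) (a : 'I_n -> R) (u : 'I_n -> R -> R),
        (forall i, L2 mu (u i)) ->
        gaussian (fun w => \sum_i a i * W (u i) w),
      forall u, L2 mu u -> ('E_P[W u] = 0)%E
    & forall u v, L2 mu u -> L2 mu v ->
        ('E_P[(fun w => W u w * W v w)%R] = (ip mu u v)%:E)%E].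

(* Y_n under the signal s, seen as a random functional on L2. *)
Definition data (W : (R -> R) -> {RV P >-> R}) (s : R -> R) (n : nat) (w : T) :
    (R -> R) -> R :=
  fun u => ip mu s u + W u w / Num.sqrt n%:R.

Definition linear_on (V : set (R -> R)) (y : (R -> R) -> R) : Prop :=
  forall (a : R) u v, V u -> V v ->
    y (fun x => a * u x + v x) = a * y u + y v.

Definition contrast (y : (R -> R) -> R) (u : R -> R) : R :=
  - 2 * y u + nrm mu u ^+ 2.

Definition shat (y : (R -> R) -> R) (m : set (R -> R)) : R -> R :=
  xget (fun=> 0)
    [set u | m u /\ forall v, m v -> contrast y u <= contrast y v].

(* A selection rule maps the sample size and the data to a model. The contrast
   has a minimizer over each model when the data act linearly on finite linear
   combinations of the basis functions; only there is the rule constrained. *)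
Definition selection_rule (phi psi : R -> R) (theta : R) (lambda : nat -> R)
    (j0 : nat -> int) (mt : nat -> ((R -> R) -> R) -> set (R -> R)) : Prop :=
  forall n y, (0 < n)%N ->
    linear_on (lspan (Psi phi psi @` Psi_indices)) y ->
    models_upto phi psi theta (j0 n) (mt n y) /\
    forall m, models_upto phi psi theta (j0 n) m ->
      contrast y (shat y (mt n y)) +
        penalty phi psi theta lambda j0 n (mt n y) <=
      contrast y (shat y m) + penalty phi psi theta lambda j0 n m.

Definition rate (lambda : nat -> R) (alpha : R) (n : nat) : R :=
  (lambda n / n%:R) `^ (alpha / (1 + 2 * alpha)).

Definition maxiset_ball (W : (R -> R) -> {RV P >-> R})
    (estimator : nat -> ((R -> R) -> R) -> R -> R) (rho : nat -> R) (rad : R) :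
    set (R -> R) :=
  [set s | L2 mu s /\
    (ereal_sup
       [set ((rho n ^+ 2)^-1)%:E *
            'E_P[(fun w => nrm mu (estimator n (data W s n w) \- s) ^+ 2)%R]
       | n in [set n | (0 < n)%N]] <= (rad ^+ 2)%:E)%E].

(* F :=: G for two families of balls indexed by their radius. *)
Definition same_balls (F G : R -> set (R -> R)) : Prop :=
  (forall r, 0 < r -> exists2 r', 0 < r' & F r `<=` G r') /\
  (forall r', 0 < r' -> exists2 r, 0 < r & G r' `<=` F r).

End WhiteNoise.

Section Constants.
Context {R : realType}.

Definition gfun (delta alpha0 : R) : R :=
  (1 - delta) `^ (2 * alpha0 / (2 * alpha0 + 1)) - 1 + delta.

Definition Upsilon (delta p alpha0 : R) : R :=
  8 / (p * gfun delta alpha0) * (16 / gfun delta alpha0 + 1).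

End Constants.

(* Main.v *)
Require Import Defs.
From HB Require Import structures.
From mathcomp Require Import all_boot all_order all_algebra finmap.
From mathcomp Require Import all_classical all_reals all_analysis.
From mathcomp Require Import measurable_realfun simple_functions.
From mathcomp Require Import ring lra zify.
Import Order.TTheory GRing.Theory Num.Theory.
Import numFieldNormedType.Exports.
Local Open Scope classical_set_scope.
Local Open Scope ring_scope.
Set Implicit Arguments.
Unset Strict Implicit.
Unset Printing Implicit Defensive.

(** Everything is read in wavelet coordinates. With b_i = <s, e_i>, X_i = W(e_i)
    and xi_i = X_i / sqrt n, where e_i runs over the basis, a model is a finite
    set L of indices. Its least squares estimator has the coordinates b_i + xi_i,
    hence the contrast - sum_L (b_i + xi_i)^2 and, by Pythagoras, the squared
    loss B(L) + sum_L xi_i^2, where B(L) = |s|^2 - sum_L b_i^2 is the squared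
    bias ([loss_model], [contrast_model]). All models built from the same J have
    the same dimension D_J ([dimJE]). Put x_n = lambda_n / n and
    q = 2 alpha / (1 + 2 alpha), so that the squared rate is x_n^q.

    From the maxiset to the balls. Let Lt be the selected model and L any other
    one. As (b + xi)^2 <= 2 b^2 + 2 xi^2 on Lt \ L, the criterion yields
    pen(Lt) <= pen(L) + 2 B(L) + 2 loss(Lt) ([selected_penalty_le]). A risk at
    most v at sample size n provides one outcome where the loss is at most 2 v,
    hence a deterministic model of squared bias at most 2 v that satisfies this
    inequality against all L ([risk_selects]). Let L be the model found at n,
    extended to the maximal resolution at 2 n: its bias is already of the order
    of the squared rate, while, since lambda_{2n} <= 2 (1 - delta) lambda_n, its
    penalty divided by the squared rate is multiplied by at most
    (1 - delta)^(1 - q) < 1 between n and 2 n. By induction the penalty and the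
    squared bias of the selected models are of the order of the squared rate
    along n0 2^i ([selected_along_dyadic]). Such models approximate s well for
    their dimension ([approx_bound]), and their bias dominates the coefficients
    beyond the resolution j0(n) ([besov_bound]). At n = 1 the hypothesis
    1/2 < lambda_1 forces j0(1) <= 0, so that the risk at n = 1 controls all the
    wavelet coefficients.

    From the balls to the maxiset. Linearizing every square by
    exp(t x^2) = E exp(sqrt(2 t) g x), with g standard normal, gives the moment
    generating function of a chi-square functional of the white noise
    ([chi2_mgf]); its expected excess over l^2 D is then at most
    4 exp(- (l - 1)^2 D / 2) ([chi2_excess]). Summed over the models by the
    entropy hypothesis, this controls the noise of the selected model and yields
    an oracle inequality ([oracle_risk]). It is applied to a model of dimension
    of order x_n^(q - 1) that approximates s, truncated at the resolution j0(n):
    the approximation ball bounds the bias before truncation and the Besov ball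
    bounds what truncation adds ([bias_truncate_ball], [risk_large_n]). The
    finitely many n < n0 only require a finite risk ([risk_small_n]). *)

(** * Inner product and norm of square-integrable functions *)

Section SquareIntegrable.
Context {R : realType} (mu : {measure set (measurableTypeR R) -> \bar R}).
Implicit Types u v : R -> R.

Lemma L2_mulZ (a : R) u : L2 mu u -> L2 mu (fun x => a * u x).
Proof.
move=> hu.
have -> : (fun x => a * u x) = a \o* u by apply/funext => x /=; rewrite mulrC.
by apply: Lfun_scale => //; rewrite ler1n.
Qed.

Lemma L2D u v : L2 mu u -> L2 mu v -> L2 mu (fun x => u x + v x).
Proof.
move=> hu hv.
have h12 : (1 <= 2%:E :> \bar R)%E by rewrite lee_fin ler1n.
exact: (Lfun_addr_closed mu h12).2.
Qed.

Lemma L2_cst0 : L2 mu (fun=> 0).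
Proof.
have h12 : (1 <= 2%:E :> \bar R)%E by rewrite lee_fin ler1n.
exact: (Lfun_addr_closed mu h12).1.
Qed.

Lemma L2B u v : L2 mu u -> L2 mu v -> L2 mu (u \- v).
Proof.
move=> hu hv.
have -> : u \- v = (fun x => u x + (-1) * v x).
  by apply/funext => x /=; rewrite mulN1r.
by apply: L2D => //; exact: L2_mulZ.
Qed.

Lemma L2_sum (I : eqType) (L : seq I) (f : I -> R -> R) :
  (forall i, i \in L -> L2 mu (f i)) -> L2 mu (fun x => \sum_(i <- L) f i x).
Proof.
elim: L => [_|i L IH h].
  by under eq_fun do rewrite big_nil; exact: L2_cst0.
under eq_fun do rewrite big_cons; apply: L2D.
  by apply: h; rewrite mem_head.
by apply: IH => j jL; apply: h; rewrite inE jL orbT.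
Qed.

Lemma integrable_mul u v : L2 mu u -> L2 mu v ->
  mu.-integrable setT (EFin \o (fun x => u x * v x)).
Proof. by move=> hu hv; apply/Lfun1_integrable; exact: Lfun2_mul_Lfun1. Qed.

Lemma ipC u v : ip mu u v = ip mu v u.
Proof. by apply: eq_Rintegral => x _; rewrite mulrC. Qed.

Lemma ipDl u v w : L2 mu u -> L2 mu v -> L2 mu w ->
  ip mu (fun x => u x + v x) w = ip mu u w + ip mu v w.
Proof.
move=> hu hv hw; rewrite /ip.
rewrite -(@RintegralD _ _ _ mu setT (fun x => u x * w x) (fun x => v x * w x)) //.
- by apply: eq_Rintegral => x _; rewrite mulrDl.
- exact: integrable_mul.
- exact: integrable_mul.
Qed.

Lemma ipZl a u v : L2 mu u -> L2 mu v ->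
  ip mu (fun x => a * u x) v = a * ip mu u v.
Proof.
move=> hu hv; rewrite /ip -RintegralZl //; last exact: integrable_mul.
by apply: eq_Rintegral => x _; rewrite mulrA.
Qed.

Lemma ip_ge0 u : 0 <= ip mu u u.
Proof. by apply: Rintegral_ge0 => x _; rewrite -expr2 sqr_ge0. Qed.

Lemma ip0l v : L2 mu v -> ip mu (fun=> 0) v = 0.
Proof.
by move=> hv; have := ipZl 0 L2_cst0 hv; under eq_fun do rewrite mul0r; rewrite mul0r.
Qed.

Lemma ip_suml (I : eqType) (L : seq I) (f : I -> R -> R) v :
  (forall i, i \in L -> L2 mu (f i)) -> L2 mu v ->
  ip mu (fun x => \sum_(i <- L) f i x) v = \sum_(i <- L) ip mu (f i) v.
Proof.
elim: L => [_ hv|i L IH h hv].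
  by under eq_fun do rewrite big_nil; rewrite big_nil ip0l.
have hL j : j \in L -> L2 mu (f j) by move=> jL; apply: h; rewrite inE jL orbT.
under eq_fun do rewrite big_cons; rewrite big_cons ipDl //.
- by rewrite IH.
- by apply: h; rewrite mem_head.
- exact: L2_sum.
Qed.

Lemma Lnorm2_sqr u : L2 mu u ->
  ('N[mu]_2%:E[EFin \o u] `^ 2 = (ip mu u u)%:E)%E.
Proof.
move=> hu; have iu := Lfun2_integrable_sqr hu.
rewrite powR_Lnorm //.
have -> : (\int[mu]_x (`|(EFin \o u) x| `^ 2) = \int[mu]_x (u x ^+ 2)%:E)%E.
  apply: eq_integral => x _ /=.
  by rewrite powR_mulrn // real_normK // num_real.
rewrite /ip /Rintegral fineK; last first.
  exact: integral_fune_fin_num (integrable_mul hu hu).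
by apply: eq_integral => x _; rewrite expr2.
Qed.

Lemma Lnorm2E u : L2 mu u ->
  'N[mu]_2%:E[EFin \o u]%E = (Num.sqrt (ip mu u u))%:E.
Proof.
move=> hu; have := Lnorm2_sqr hu.
have : ('N[mu]_2%:E[EFin \o u] < +oo)%E.
  by move: (hu); rewrite /L2 /= inE => /andP[_]; rewrite inE.
have := @Lnorm_ge0 _ _ _ mu 2%:E (EFin \o u).
case: ('N[mu]_2%:E[EFin \o u])%E => [t| |] //=.
rewrite lee_fin => t0 _ [] <-.
by rewrite powR_mulrn // sqrtr_sqr ger0_norm.
Qed.

Lemma nrmE u : L2 mu u -> nrm mu u = Num.sqrt (ip mu u u).
Proof. by move=> hu; rewrite /nrm Lnorm2E. Qed.

Lemma nrm_sqr u : L2 mu u -> nrm mu u ^+ 2 = ip mu u u.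
Proof. by move=> hu; rewrite nrmE // sqr_sqrtr // ip_ge0. Qed.

End SquareIntegrable.

(** * Finite orthonormal families *)

Lemma big_seq_pick {R : realType} (I : eqType) (L : seq I) (k : I) (F : I -> R) : uniq L -> k \in L ->
  \sum_(j <- L) (k == j)%:R * F j = F k.
Proof.
move=> uL kL; rewrite (bigD1_seq k) //= eqxx mul1r big1 ?addr0 // => j jk.
by rewrite eq_sym (negbTE jk) mul0r.
Qed.

Section Orthonormal.
Context {R : realType} (mu : {measure set (measurableTypeR R) -> \bar R}).
Context (I : eqType) (D : set I) (e : I -> R -> R).
Hypothesis eL2 : forall i, D i -> L2 mu (e i).
Hypothesis eon : forall i j, D i -> D j -> ip mu (e i) (e j) = (i == j)%:R.
Implicit Types (L : seq I) (a b : I -> R) (s : R -> R).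

Definition comb L a : R -> R := fun x => \sum_(i <- L) a i * e i x.

(** Vectors of the family may be repeated in [lspan]; their weights are added up. *)
Lemma lspan_comb L : uniq L -> lspan (e @` [set` L]) = range (comb L).
Proof.
move=> uL; apply/seteqP; split => [f [n [c [g [gE ->]]]]|_ [a _ <-]].
  have /choice[h hP] : forall i : 'I_n, exists j, j \in L /\ e j = g i.
    by move=> i; have [j jL <-] := gE i; exists j.
  exists (fun j => \sum_(i < n) c i * (h i == j)%:R) => //.
  apply/funext => x; rewrite /comb.
  under eq_bigr do rewrite mulr_suml.
  rewrite exchange_big /=; apply: eq_bigr => i _.
  under eq_bigr do rewrite -mulrA.
  rewrite -mulr_sumr; congr (_ * _).
  by rewrite (big_seq_pick (fun j => e j x)) ?(hP i).1 ?(hP i).2.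
exists (size L), (fun i => a (tnth (in_tuple L) i)),
  (fun i => e (tnth (in_tuple L) i)); split.
  by move=> i; exists (tnth (in_tuple L) i) => //; exact: mem_tnth.
by apply/funext => x; rewrite /comb big_tnth.
Qed.

Section Fixed.
Variable L : seq I.
Hypothesis uL : uniq L.
Hypothesis LD : forall i, i \in L -> D i.

Lemma comb_in_span a : lspan (e @` D) (comb L a).
Proof.
have : range (comb L) (comb L a) by exists a.
rewrite -(lspan_comb uL) => -[n [c [g [gE ->]]]].
exists n, c, g; split => // i; have [j jL <-] := gE i.
by exists j => //; exact: LD.
Qed.

Lemma comb_L2 a : L2 mu (comb L a).
Proof.
by apply: (@L2_sum _ mu _ L (fun i x => a i * e i x)) => i iL; apply: L2_mulZ; apply: eL2; apply: LD.
Qed.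

Lemma ip_comb a s : L2 mu s ->
  ip mu (comb L a) s = \sum_(i <- L) a i * ip mu (e i) s.
Proof.
move=> hs; rewrite /comb (@ip_suml _ mu _ L (fun i x => a i * e i x)) //; last first.
  by move=> i iL; apply: L2_mulZ; apply: eL2; apply: LD.
apply: eq_big_seq => i iL; rewrite ipZl //; exact/eL2/LD.
Qed.

Lemma ip_comb_coord a k : D k -> ip mu (comb L a) (e k) = if k \in L then a k else 0.
Proof.
move=> Dk; rewrite ip_comb; last exact: eL2.
case: ifPn => kL; last first.
  rewrite big_seq big1 // => i iL; rewrite eon //; last exact: LD.
  by rewrite (_ : (i == k) = false) ?mulr0 //; apply: contraNF kL => /eqP <-.
transitivity (\sum_(i <- L) (k == i)%:R * a i).
  by apply: eq_big_seq => i iL; rewrite eon // ?[k == i]eq_sym 1?mulrC //; exact: LD.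
exact: big_seq_pick.
Qed.

Lemma ip_comb2 a b : ip mu (comb L a) (comb L b) = \sum_(i <- L) a i * b i.
Proof.
rewrite ip_comb; last exact: comb_L2.
by apply: eq_big_seq => i iL; rewrite ipC ip_comb_coord ?iL //; exact: LD.
Qed.

(** Pythagoras: the distance splits into the part of [s] outside the span and the
    errors on the coordinates. *)
Lemma ip_comb_sub a s : L2 mu s ->
  ip mu (comb L a \- s) (comb L a \- s) =
  ip mu s s - \sum_(i <- L) ip mu s (e i) ^+ 2
            + \sum_(i <- L) (a i - ip mu s (e i)) ^+ 2.
Proof.
move=> hs; have hc := comb_L2 a.
have hN u : L2 mu u -> L2 mu (fun x => (-1) * u x) by exact: L2_mulZ.
have subE u v : u \- v = (fun x => u x + (-1) * v x).
  by apply/funext => x /=; rewrite mulN1r.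
rewrite {1}subE ipDl ?ipZl //; try exact: hN; try exact: L2B.
rewrite (ipC mu _ (comb L a \- s)) (ipC mu s (comb L a \- s)) !subE.
rewrite !ipDl ?ipZl //; try exact: hN.
rewrite ip_comb2 (ipC mu s (comb L a)) ip_comb //.
have -> : \sum_(i <- L) (a i - ip mu s (e i)) ^+ 2 =
  \sum_(i <- L) a i * a i - 2 * \sum_(i <- L) a i * ip mu (e i) s
   + \sum_(i <- L) ip mu s (e i) ^+ 2.
  rewrite mulr_sumr -sumrB -big_split /=; apply: eq_bigr => i _.
  by rewrite (ipC mu (e i)); ring.
ring.
Qed.

Lemma bessel s : L2 mu s -> \sum_(i <- L) ip mu s (e i) ^+ 2 <= ip mu s s.
Proof.
move=> hs; have := ip_comb_sub (fun i => ip mu s (e i)) hs.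
under [X in _ + X]eq_bigr do rewrite subrr expr0n /=.
rewrite big1_eq addr0 => h; rewrite -subr_ge0 -h; exact: ip_ge0.
Qed.

Lemma nrm_comb_sub a s : L2 mu s ->
  nrm mu (comb L a \- s) ^+ 2 =
  ip mu s s - \sum_(i <- L) ip mu s (e i) ^+ 2
            + \sum_(i <- L) (a i - ip mu s (e i)) ^+ 2.
Proof.
by move=> hs; rewrite nrm_sqr ?ip_comb_sub //; apply: L2B => //; exact: comb_L2.
Qed.

(** Orthogonality to the span fixes every coordinate, so the choice made by [oproj]
    is unique as a function, not only almost everywhere. *)
Lemma oproj_comb s : L2 mu s ->
  oproj mu (lspan (e @` [set` L])) s = comb L (fun i => ip mu s (e i)).
Proof.
move=> hs; rewrite /oproj (lspan_comb uL).
set Q := (X in xget _ X).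
have inj a : (forall u, range (comb L) u -> ip mu (s \- comb L a) u = 0) <->
    (forall i, i \in L -> a i = ip mu s (e i)).
  have subE : s \- comb L a = (fun x => s x + (-1) * comb L a x).
    by apply/funext => x /=; rewrite mulN1r.
  have hc := comb_L2 a.
  have hN : L2 mu (fun x => (-1) * comb L a x) by exact: L2_mulZ.
  split => [h i iL|h u [b _ <-]].
    have Di := LD iL; have ei := eL2 Di.
    have : ip mu (s \- comb L a) (e i) = 0.
      apply: h; exists (fun j => (i == j)%:R) => //.
      by apply/funext => x; rewrite /comb (big_seq_pick (fun j => e j x)).
    rewrite subE ipDl // ipZl // ip_comb_coord // iL; lra.
  have hb := comb_L2 b.
  rewrite subE ipDl // ipZl // ip_comb2 ipC ip_comb //.
  rewrite mulN1r -sumrB big_seq big1 // => i iL.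
  by rewrite h // (ipC mu (e i)); ring.
have : Q (xget (fun=> 0) Q).
  apply: xgetPex; exists (comb L (fun i => ip mu s (e i))); split.
    by exists (fun i => ip mu s (e i)).
  by apply/inj.
case=> -[a _ <-] /inj h; apply/funext => x.
by apply: eq_big_seq => i iL; rewrite h.
Qed.

Lemma nrm_oproj s : L2 mu s ->
  nrm mu (oproj mu (lspan (e @` [set` L])) s \- s) ^+ 2 =
  ip mu s s - \sum_(i <- L) ip mu s (e i) ^+ 2.
Proof.
move=> hs; rewrite oproj_comb // nrm_comb_sub //.
under [X in _ + X = _]eq_bigr do rewrite subrr expr0n /=.
by rewrite big1_eq addr0.
Qed.

Lemma comb_lspanE f : lspan (e @` [set` L]) f -> exists a, f = comb L a.
Proof. by rewrite (lspan_comb uL) => -[a _ <-]; exists a. Qed.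

Lemma has_dim_comb : has_dim mu (lspan (e @` [set` L])) (size L).
Proof.
pose h (k : 'I_(size L)) := tnth (in_tuple L) k.
have hL k : h k \in L by exact: mem_tnth.
have hinj : injective h by apply/tuple_uniqP.
pose c (a : 'I_(size L) -> R) := fun i => \sum_k a k * (i == h k)%:R.
have cE (a : 'I_(size L) -> R) : comb L (c a) = (fun x => \sum_k a k * e (h k) x).
  apply/funext => x; rewrite /comb.
  under eq_bigr do rewrite mulr_suml.
  rewrite exchange_big /=; apply: eq_bigr => k _.
  under eq_bigr do rewrite -mulrA eq_sym.
  by rewrite -mulr_sumr (big_seq_pick (fun j => e j x)).
exists (fun k => e (h k)); split.
- by move=> k; apply/eL2/LD.
- move=> a; rewrite -cE Lnorm2E; last exact: comb_L2.
  move=> [] /eqP; rewrite sqrtr_eq0 ip_comb2 => h0 k.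
  have /eqP : \sum_(i <- L) c a i * c a i = 0.
    apply/eqP; rewrite eq_le h0 sumr_ge0 // => i _.
    by rewrite -expr2 sqr_ge0.
  rewrite psumr_eq0 => [/allP az|i _]; last by rewrite -expr2 sqr_ge0.
  have := az _ (hL k); rewrite mulf_eq0 orbb /c (bigD1 k) //= eqxx mulr1 big1.
    by rewrite addr0 => /eqP.
  move=> k' kk'; rewrite (_ : (h k == h k') = false) ?mulr0 //.
  by apply: contraNF kk' => /eqP /hinj ->.
- congr lspan; apply/seteqP; split => [_ [k _ <-]|_ [i iL <-]].
    by exists (h k) => //; exact: hL.
  have /tnthP[k ->] : i \in in_tuple L by [].
  by exists k.
Qed.

(** The matrices that express two bases in each other are mutually inverse: one
    product is read off by orthonormality, the other by linear independence. Ranks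
    then compare the sizes. *)
Lemma has_dim_uniq dm : has_dim mu (lspan (e @` [set` L])) dm -> dm = size L.
Proof.
case=> f [fL2 ffree fspan].
pose h (k : 'I_(size L)) := tnth (in_tuple L) k.
have hL k : h k \in L by exact: mem_tnth.
have hinj : injective h by apply/tuple_uniqP.
have bigL F : \sum_(i <- L) F i = \sum_k F (h k) :> R by rewrite big_tnth.
have combE a : comb L a = fun x => \sum_k a (h k) * e (h k) x.
  by apply/funext => x; rewrite /comb bigL.
have /choice[A hA] : forall i, exists a : I -> R, f i = comb L a.
  move=> i; apply: comb_lspanE; rewrite -fspan.
  exists 1%N, (fun=> 1), (fun=> f i); split=> [_|]; first by exists i.
  by apply/funext => x; rewrite big_ord1 mul1r.
have /choice[B hB] : forall k, exists b : 'I_dm -> R,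
    e (h k) = fun x => \sum_i b i * f i x.
  move=> k; have : lspan (range f) (e (h k)).
    rewrite fspan; exists 1%N, (fun=> 1), (fun=> e (h k)); split=> [_|].
      by exists (h k) => //; exact: hL.
    by apply/funext => x; rewrite big_ord1 mul1r.
  move=> [n [c [g [gE ->]]]].
  have /choice[t ht] : forall j, exists i, f i = g j.
    by move=> j; have [i _ <-] := gE j; exists i.
  exists (fun i => \sum_(j < n | t j == i) c j); apply/funext => x.
  under [RHS]eq_bigr do rewrite mulr_suml.
  rewrite (exchange_big_dep predT) //=; apply: eq_bigr => j _.
  by rewrite (big_pred1 (t j)) ?ht // => i; rewrite eq_sym.
pose MA : 'M[R]_(dm, size L) := \matrix_(i, k) A i (h k).
pose MB : 'M[R]_(size L, dm) := \matrix_(k, i) B k i.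
have e1 : MB *m MA = 1%:M.
  apply/matrixP => k l; rewrite !mxE.
  under eq_bigr do rewrite !mxE.
  have ek : e (h k) = comb L (fun j => \sum_i B k i * A i j).
    rewrite {1}hB; apply/funext => x; rewrite /comb.
    under eq_bigr do rewrite hA /comb mulr_sumr.
    rewrite exchange_big; apply: eq_bigr => i _ /=.
    by rewrite mulr_suml; apply: eq_bigr => j _; rewrite mulrA.
  have := eon (LD (hL k)) (LD (hL l)).
  rewrite {1}ek ip_comb_coord ?hL //; last exact: LD.
  by move=> ->; rewrite (inj_eq hinj).
have e2 : MA *m MB = 1%:M.
  apply/matrixP => i j; rewrite !mxE.
  under eq_bigr do rewrite !mxE.
  pose c j := \sum_k A i (h k) * B k j - (i == j)%:R.
  suff /(_ j) : forall j, c j = 0 by rewrite /c => /eqP; rewrite subr_eq0 => /eqP.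
  apply: ffree; rewrite (_ : EFin \o _ = cst 0%E) ?Lnorm0 //.
  apply/funext => x /=; congr EFin; rewrite /c.
  under eq_bigr do rewrite mulrBl.
  rewrite sumrB (big_seq_pick (L := index_enum _) (fun j => f j x)) ?mem_index_enum ?index_enum_uniq //.
  under eq_bigr do rewrite mulr_suml.
  rewrite exchange_big /= hA combE.
  apply/eqP; rewrite subr_eq0; apply/eqP; apply: eq_bigr => k _.
  rewrite hB mulr_sumr; apply: eq_bigr => l _; rewrite mulrA.
  by [].
apply/eqP; rewrite eqn_leq; apply/andP; split.
  have := mulmx_max_rank MA MB; rewrite e2 mxrank1; exact.
have := mulmx_max_rank MB MA; rewrite e1 mxrank1; exact.
Qed.

Lemma l2dim_comb : l2dim mu (lspan (e @` [set` L])) = size L.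
Proof.
rewrite /l2dim; set Q := (X in xget _ X).
have : Q (xget 0%N Q) by apply: xgetPex; exists (size L); exact: has_dim_comb.
exact: has_dim_uniq.
Qed.

Section LinearFunctional.
Variable y : (R -> R) -> R.
Hypothesis ylin : linear_on (lspan (e @` D)) y.

Lemma linear_on_comb a : y (comb L a) = \sum_(i <- L) a i * y (e i).
Proof.
have ein i : D i -> lspan (e @` D) (e i).
  move=> Di; exists 1%N, (fun=> 1), (fun=> e i); split=> [_|]; first by exists i.
  by apply/funext => x; rewrite big_ord1 mul1r.
have z0 : lspan (e @` D) (fun=> 0).
  exists 0%N, (fun=> 0), (fun=> fun=> 0); split=> [[]//|].
  by apply/funext => x; rewrite big_ord0.
have y0 : y (fun=> 0) = 0.
  have := ylin 1 z0 z0.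
  have -> : (fun x : R => 1 * 0 + 0) = (fun=> 0 : R) by apply/funext => x; ring.
  lra.
have H : forall L', uniq L' -> (forall i, i \in L' -> D i) ->
    lspan (e @` D) (comb L' a) /\ y (comb L' a) = \sum_(i <- L') a i * y (e i).
  elim=> [_ _|i L' IH /= /andP[_ uL'] hD].
    rewrite big_nil (_ : comb _ _ = fun=> 0) //.
    by apply/funext => x; rewrite /comb big_nil.
  have [h1 h2] : _ /\ _ := IH uL' (fun j jL => hD j (mem_behead (s := i :: L') jL)).
  have cE : comb (i :: L') a = (fun x => a i * e i x + comb L' a x).
    by apply/funext => x; rewrite /comb big_cons.
  have Di : D i by apply: hD; rewrite mem_head.
  split; last by rewrite cE ylin ?big_cons ?h2 //; exact: ein.
  rewrite cE; have [n [c [g [gE ->]]]] := h1.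
  exists n.+1, (fun k => oapp c (a i) (unlift ord0 k)),
    (fun k => oapp g (e i) (unlift ord0 k)); split.
    by move=> k; case: unliftP => [k' _|_] /=; [exact: gE|exists i].
  apply/funext => x; rewrite big_ord_recl /= unlift_none /=; congr (_ + _).
  by apply: eq_bigr => k _; rewrite liftK.
exact: (H L uL LD).2.
Qed.

End LinearFunctional.

End Fixed.
End Orthonormal.

Section Spans.
Context {R : realType}.

Lemma lspan_lin (E : set (R -> R)) (a : R) (u v : R -> R) :
  lspan E u -> lspan E v -> lspan E (fun x => a * u x + v x).
Proof.
move=> [n [c [g [gE ->]]]] [m [c' [g' [gE' ->]]]].
exists (n + m)%N, (fun k => match fintype.split k with inl i => a * c i | inr j => c' j end),
  (fun k => match fintype.split k with inl i => g i | inr j => g' j end); split.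
  by move=> k; case: fintype.split.
apply/funext => x; rewrite big_split_ord /= mulr_sumr; congr (_ + _).
  by apply: eq_bigr => i _; rewrite (unsplitK (inl i)) mulrA.
by apply: eq_bigr => i _; rewrite (unsplitK (inr i)).
Qed.

Lemma lspan_L2 (mu : {measure set (measurableTypeR R) -> \bar R}) (E : set (R -> R)) :
  E `<=` L2 mu -> lspan E `<=` L2 mu.
Proof.
move=> EL2 _ [n [c [g [gE ->]]]].
apply: (@L2_sum _ mu _ (index_enum _) (fun i x => c i * g i x)) => i _.
by apply: L2_mulZ; exact/EL2/gE.
Qed.

Lemma lspan_0 (E : set (R -> R)) : lspan E (fun=> 0).
Proof.
exists 0%N, (fun=> 0), (fun=> fun=> 0); split=> [[]//|].
by apply/funext => x; rewrite big_ord0.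
Qed.

End Spans.

Section Contrast.
Context {R : realType}.
Local Notation mu := (@leb01 R).
Context (I : eqType) (D : set I) (e : I -> R -> R).
Hypothesis eL2 : forall i, D i -> L2 mu (e i).
Hypothesis eon : forall i j, D i -> D j -> ip mu (e i) (e j) = (i == j)%:R.
Variables (L : seq I) (y : (R -> R) -> R).
Hypothesis uL : uniq L.
Hypothesis LD : forall i, i \in L -> D i.
Hypothesis ylin : linear_on (lspan (e @` D)) y.
Implicit Types a : I -> R.

(** Completing the square in each coordinate. *)
Lemma contrast_comb a :
  contrast y (comb e L a) =
  - \sum_(i <- L) y (e i) ^+ 2 + \sum_(i <- L) (a i - y (e i)) ^+ 2.
Proof.
rewrite /contrast nrm_sqr; last exact: comb_L2 eL2 L LD _.
rewrite (ip_comb2 eL2 eon uL LD) (linear_on_comb uL LD ylin) mulr_sumr -big_split /= -sumrN -big_split /=.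
by apply: eq_bigr => i _; ring.
Qed.

Lemma shat_comb : shat y (lspan (e @` [set` L])) = comb e L (fun i => y (e i)).
Proof.
rewrite /shat (lspan_comb e uL); set Q := (X in xget _ X).
have : Q (xget (fun=> 0) Q).
  apply: xgetPex; exists (comb e L (fun i => y (e i))); split.
    by exists (fun i => y (e i)).
  move=> _ [a _ <-]; rewrite !contrast_comb lerD2l.
  under eq_bigr do rewrite subrr expr0n /=.
  by rewrite big1_eq sumr_ge0 // => i _; exact: sqr_ge0.
case=> -[a _ <-] h; have := h (comb e L (fun i => y (e i))).
rewrite !contrast_comb lerD2l.
under [X in _ -> _ <= X]eq_bigr do rewrite subrr expr0n /=.
rewrite big1_eq => /(_ (ex_intro2 _ _ _ Logic.I erefl)) h0.
have /eqP : \sum_(i <- L) (a i - y (e i)) ^+ 2 = 0.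
  by apply/eqP; rewrite eq_le h0 sumr_ge0 // => i _; exact: sqr_ge0.
rewrite psumr_eq0 => [/allP az|i _]; last exact: sqr_ge0.
apply/funext => x; apply: eq_big_seq => i iL.
by have := az i iL; rewrite sqrf_eq0 subr_eq0 => /eqP ->.
Qed.

Lemma contrast_shat :
  contrast y (shat y (lspan (e @` [set` L]))) = - \sum_(i <- L) y (e i) ^+ 2.
Proof.
rewrite shat_comb contrast_comb.
under [X in _ + X]eq_bigr do rewrite subrr expr0n /=.
by rewrite big1_eq addr0.
Qed.

End Contrast.

(** * Integrals of functions that need not be measurable *)

Section IntegralMonotonicity.
Context d (T : measurableType d) (R : realType) (mu : {measure set T -> \bar R}).
Implicit Types f g : T -> \bar R.
Local Open Scope ereal_scope.

Import HBNNSimple.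

Lemma measurable_fun_in (N : set T) : measurable N ->
  measurable_fun [set: T] (fun x => x \in N).
Proof.
move=> mN; apply: (measurable_fun_bool true).
rewrite setTI (_ : _ @^-1` _ = N) //.
by apply/seteqP; split => x /= => [/set_mem|/mem_set].
Qed.

(** The integral of a nonnegative function is a supremum over the simple functions
    below it. This compares risks before the selected estimator is known to be
    measurable. *)
Lemma ge0_le_integral_nomeas f g : (forall x, 0 <= f x) ->
  (forall x, f x <= g x) -> \int[mu]_x f x <= \int[mu]_x g x.
Proof.
move=> f0 fg; have g0 x : 0 <= g x by exact: le_trans (f0 x) (fg x).
rewrite !ge0_integralTE //; apply: le_ereal_sup => _ [h hf <-].
by exists h => // x; exact: le_trans (hf x) (fg x).
Qed.

(** Set [g] to +oo on a null set where the inequality fails. *)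
Lemma ae_le_integral_measr f g : (forall x, 0 <= f x) -> (forall x, 0 <= g x) ->
  measurable_fun [set: T] g -> {ae mu, forall x, f x <= g x} ->
  \int[mu]_x f x <= \int[mu]_x g x.
Proof.
move=> f0 g0 mg [N [mN N0 hN]].
pose g' x := if x \in N then +oo else g x.
have mg' : measurable_fun [set: T] g'.
  by apply: measurable_fun_ifT => //; exact: measurable_fun_in.
apply: (@le_trans _ _ (\int[mu]_x g' x)).
  apply: ge0_le_integral_nomeas => // x; rewrite /g'; case: ifPn => [_|xN].
    exact: leey.
  apply: contrapT => h; move/negP: xN; apply; rewrite inE; exact: hN.
rewrite le_eqVlt; apply/orP; left; apply/eqP.
apply: ge0_ae_eq_integral => //.
- by move=> x _; rewrite /g'; case: ifP => _; [exact: le0y|].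
- exists N; split => // x /= h; apply: contrapT => xN; apply: h => _.
  by rewrite /g' memNset.
Qed.

(** Set [f] to 0 on a null set where the inequality fails. *)
Lemma ae_le_integral_measl f g : (forall x, 0 <= f x) -> (forall x, 0 <= g x) ->
  measurable_fun [set: T] f -> {ae mu, forall x, f x <= g x} ->
  \int[mu]_x f x <= \int[mu]_x g x.
Proof.
move=> f0 g0 mf [N [mN N0 hN]].
pose f' x := if x \in N then 0 else f x.
have mf' : measurable_fun [set: T] f'.
  by apply: measurable_fun_ifT => //; exact: measurable_fun_in.
have f'0 x : 0 <= f' x by rewrite /f'; case: ifP.
apply: (@le_trans _ _ (\int[mu]_x f' x)); last first.
  apply: ge0_le_integral_nomeas => // x; rewrite /f'; case: ifPn => // xN.
  apply: contrapT => h; move/negP: xN; apply; rewrite inE; exact: hN.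
rewrite le_eqVlt; apply/orP; left; apply/eqP.
apply: ge0_ae_eq_integral => //.
exists N; split => // x /= h; apply: contrapT => xN; apply: h => _.
by rewrite /f' memNset.
Qed.

End IntegralMonotonicity.

Section NormalIntegrals.
Context {R : realType}.
Local Notation leb := (@lebesgue_measure R).

(** The normal law is absolutely continuous, and its Radon-Nikodym derivative is
    almost everywhere the density that defines it. *)
Lemma ge0_integral_normal_prob (m s : R) (f : R -> \bar R) :
  measurable_fun setT f -> (forall x, (0 <= f x)%E) ->
  (\int[normal_prob m s]_x f x = \int[leb]_x (f x * (normal_pdf m s x)%:E))%E.
Proof.
move=> mf f0.
have dom := normal_prob_dominates m s.
rewrite -(Radon_Nikodym_SigmaFinite.change_of_variables dom) //.
apply: ge0_ae_eq_integral => //.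
- apply: emeasurable_funM => //.
  exact: measurable_int (Radon_Nikodym_SigmaFinite.f_integrable dom).
- apply: emeasurable_funM => //.
  by apply/measurable_EFinP; exact: measurable_normal_pdf.
- by move=> x _; rewrite mule_ge0 // Radon_Nikodym_SigmaFinite.f_ge0.
- by move=> x _; rewrite mule_ge0 // lee_fin normal_pdf_ge0.
- apply: ae_eqe_mul2l; apply: integral_ae_eq => //.
  + exact: Radon_Nikodym_SigmaFinite.f_integrable.
  + by apply/measurable_EFinP; exact: measurable_normal_pdf.
  + by move=> E _ mE; rewrite -Radon_Nikodym_SigmaFinite.f_integral.
Qed.

(** Completing the square: an exponential tilt shifts the mean. *)
Lemma expR_mul_normal_pdf (c m s x : R) : s != 0 ->
  expR (c * x) * normal_pdf m s x =
  expR (c * m + c ^+ 2 * s ^+ 2 / 2) * normal_pdf (m + c * s ^+ 2) s x.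
Proof.
move=> s0; rewrite !normal_pdfE // /normal_fun [LHS]mulrCA [RHS]mulrCA -!expRD; congr (_ * expR _).
rewrite -mulr_natr; field; by rewrite s0.
Qed.

Lemma integral_expR_normal_pdf (c m s : R) : s != 0 ->
  (\int[leb]_x ((expR (c * x))%:E * (normal_pdf m s x)%:E) =
   (expR (c * m + c ^+ 2 * s ^+ 2 / 2))%:E)%E.
Proof.
move=> s0.
under eq_integral do rewrite -EFinM expR_mul_normal_pdf // EFinM.
rewrite ge0_integralZl_EFin ?expR_ge0 //.
- by rewrite integral_normal_pdf mule1.
- by move=> x _; rewrite lee_fin normal_pdf_ge0.
- by apply/measurable_EFinP; exact: measurable_normal_pdf.
Qed.

(** A quadratic tilt rescales the standard deviation; [a] may be negative. *)
Lemma expR_sqr_normal_pdf (a s x : R) : s != 0 -> 0 < 1 + 2 * a * s ^+ 2 ->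
  let q := Num.sqrt (1 + 2 * a * s ^+ 2) in
  expR (- a * x ^+ 2) * normal_pdf 0 s x = q^-1 * normal_pdf 0 (s / q) x.
Proof.
move=> s0 q0 q.
have qgt0 : 0 < q by rewrite sqrtr_gt0.
have q2 : q ^+ 2 = 1 + 2 * a * s ^+ 2 by rewrite sqr_sqrtr // ltW.
have qn0 : q != 0 by rewrite gt_eqF.
have sq0 : s / q != 0 by rewrite mulf_neq0 // invr_neq0.
rewrite !normal_pdfE // /normal_fun !subr0 [LHS]mulrCA -expRD [RHS]mulrA.
have -> : q^-1 * normal_peak (s / q) = normal_peak s.
  rewrite /normal_peak.
  have -> : (s / q) ^+ 2 * pi *+ 2 = (s ^+ 2 * pi *+ 2) * q^-1 ^+ 2.
    by field.
  have h0 : 0 <= s ^+ 2 * pi *+ 2 by rewrite mulrn_wge0 // mulr_ge0 ?sqr_ge0 ?pi_ge0.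
  rewrite sqrtrM // sqrtr_sqr.
  by rewrite ger0_norm ?invr_ge0 ?ltW // invfM invrK mulrCA mulVf // mulr1.
congr (_ * expR _).
rewrite expr_div_n q2; field.
by rewrite s0 -q2 expf_neq0.
Qed.

Lemma integral_expR_sqr_normal_pdf (a s : R) : s != 0 -> 0 < 1 + 2 * a * s ^+ 2 ->
  (\int[leb]_x ((expR (- a * x ^+ 2))%:E * (normal_pdf 0 s x)%:E) =
   ((Num.sqrt (1 + 2 * a * s ^+ 2))^-1)%:E)%E.
Proof.
move=> s0 q0.
under eq_integral do rewrite -EFinM expR_sqr_normal_pdf // EFinM.
rewrite ge0_integralZl_EFin ?invr_ge0 ?sqrtr_ge0 //.
- by rewrite integral_normal_pdf mule1.
- by move=> x _; rewrite lee_fin normal_pdf_ge0.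
- by apply/measurable_EFinP; exact: measurable_normal_pdf.
Qed.

End NormalIntegrals.

(** * Centred Gaussian variables *)

Section GaussianMoments.
Context {R : realType} (d : measure_display) (T : measurableType d)
  (P : probability T R).

Lemma gaussian_transfer (Z : T -> R) (m s : R) (f : R -> R) :
  measurable_fun [set: T] Z ->
  (forall A : set (measurableTypeR R), measurable A ->
     P (Z @^-1` A) = gaussian_law m s A) ->
  measurable_fun [set: R] f -> (forall x, 0 <= f x) ->
  (\int[P]_w (f (Z w))%:E)%E = if s == 0 then (f m)%:E
     else (\int[lebesgue_measure]_x ((f x)%:E * (normal_pdf m s x)%:E))%E.
Proof.
move=> mZ law mf f0.
have mf' : measurable_fun [set: measurableTypeR R] (EFin \o f).
  exact/measurable_EFinP.
have f0' x : (0 <= (EFin \o f) x)%E by rewrite lee_fin.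
have mZ' : measurable_fun [set: T] (Z : T -> measurableTypeR R) by [].
transitivity (\int[pushforward P (Z : T -> measurableTypeR R)]_x (EFin \o f) x)%E.
  by rewrite ge0_integral_pushforward.
have [s0|s0] := eqVneq s 0.
  transitivity (\int[@dirac _ (measurableTypeR R) m R]_x (EFin \o f) x)%E.
    apply: eq_measure_integral => A mA _.
    by have := law A mA; rewrite /gaussian_law s0 eqxx.
  by rewrite integral_dirac // diracT mul1e.
transitivity (\int[normal_prob m s]_x (EFin \o f) x)%E.
  apply: eq_measure_integral => A mA _.
  by have := law A mA; rewrite /gaussian_law (negbTE s0).
exact: ge0_integral_normal_prob.
Qed.

(** The last clause is the Laplace transform of the square, from which the variance
    is recovered. *)
Lemma gaussian_mgf (Z : T -> R) : measurable_fun [set: T] Z -> gaussian P Z ->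
  exists m v : R, [/\ 0 <= v,
    forall c, (\int[P]_w (expR (c * Z w))%:E = (expR (c * m + c ^+ 2 * v / 2))%:E)%E
    & m = 0 -> forall a, 0 < a -> (\int[P]_w (expR (- a * Z w ^+ 2))%:E =
       ((Num.sqrt (1 + 2 * a * v))^-1)%:E)%E].
Proof.
move=> mZ [m [s law]]; exists m, (s ^+ 2); split; first exact: sqr_ge0.
  move=> c; rewrite (gaussian_transfer mZ law (f := fun x => expR (c * x))).
  - have [->|s0] := eqVneq s 0; last exact: integral_expR_normal_pdf.
    by rewrite expr0n /= mulr0 mul0r addr0.
  - by apply: measurableT_comp => //; exact: measurable_funM.
  - by move=> x; exact: expR_ge0.
move=> m0 a a0; rewrite (gaussian_transfer mZ law (f := fun x => expR (- a * x ^+ 2))).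
- have [->|s0] := eqVneq s 0; rewrite m0.
    by rewrite expr0n /= !mulr0 addr0 expR0 sqrtr1 invr1.
  apply: integral_expR_sqr_normal_pdf => //.
  by have := sqr_ge0 s; nra.
- by apply: measurableT_comp => //; apply: measurable_funM => //; exact: measurable_funX.
- by move=> x; exact: expR_ge0.
Qed.

Lemma le_of_small_quadratic (v v0 : R) : 0 <= v -> 0 <= v0 ->
  (forall a, 0 < a -> 2 * v <= v0 * (1 + a * v) * (2 + a * v)) -> v <= v0.
Proof.
move=> v_ge0 v0_ge0 h; rewrite leNgt; apply/negP => lt.
have v_gt0 : 0 < v by lra.
(* Small enough for the quadratic terms in b, yet of the order of v - v0. *)
pose b := (v - v0) / (2 * v).
have b0 : 0 < b by rewrite divr_gt0 //; lra.
have bv : b * (2 * v) = v - v0 by rewrite divfK // gt_eqF //; lra.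
have := h (b / v); rewrite divfK ?gt_eqF // => /(_ (divr_gt0 b0 v_gt0)).
nra.
Qed.

(** The parameters of the law have to be recovered from the two moments. The mean
    vanishes because 1 + c z <= exp (c z) forces 0 <= c m + c^2 v / 2 for all c.
    The variance parameter is at most [v0] because 1 <= exp (- a z^2) + a z^2
    forces 1 <= (1 + 2 a v)^(-1/2) + a v0 for all a > 0; let a tend to 0. *)
Lemma gaussian_centered_mgf (Z : T -> R) (v0 : R) :
  measurable_fun [set: T] Z -> gaussian P Z -> ('E_P[Z] = 0)%E ->
  ('E_P[(fun w => Z w * Z w)%R] = v0%:E)%E ->
  (\int[P]_w (expR (Z w))%:E <= (expR (v0 / 2))%:E)%E.
Proof.
move=> mZ gZ EZ EZ2; have [m [v [v_ge0 mgf mgf2]]] := gaussian_mgf mZ gZ.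
have iZ2 : (\int[P]_w (Z w ^+ 2)%:E = v0%:E)%E.
  by rewrite -EZ2 unlock; apply: eq_integral => w _; rewrite expr2.
have v0_ge0 : 0 <= v0.
  rewrite -lee_fin -iZ2; apply: integral_ge0 => w _; rewrite lee_fin; exact: sqr_ge0.
have intZ : P.-integrable setT (EFin \o Z).
  apply/Lfun1_integrable; apply: Lfun_subset12.
    exact: fin_num_measure.
  rewrite inE; apply/andP; split; rewrite inE //=.
  rewrite /finite_norm unlock; apply: poweR_lty.
  have -> : (\int[P]_x (`|(EFin \o Z) x| `^ 2) = \int[P]_x (Z x ^+ 2)%:E)%E.
    apply: eq_integral => x _ /=.
    by rewrite powR_mulrn // real_normK // num_real.
  by rewrite iZ2 ltry.
have m0 : m = 0.
  suff H c : 0 <= c * m + c ^+ 2 * v / 2.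
    apply/eqP/negPn/negP => mn0.
    have v10 : 0 < v + 1 by rewrite ltr_wpDl.
    pose q := m / (v + 1).
    have qE : q * (v + 1) = m by rewrite divfK // gt_eqF.
    have q0 : 0 < q ^+ 2 by rewrite exprn_even_gt0 //= mulf_neq0 // invr_neq0 // gt_eqF.
    have := H (- q); rewrite -qE sqrrN => hq.
    by clear -hq q0 v_ge0; nra.
  rewrite -ler_expR expR0 -lee_fin -mgf.
  have mcZ : measurable_fun [set: T] (fun w => expR (c * Z w)).
    by apply: measurableT_comp => //; exact: measurable_funM.
  have icst : P.-integrable setT (EFin \o cst (1 : R)).
    exact: finite_measure_integrable_cst.
  have icZ : P.-integrable setT (fun w => (c * Z w)%:E).
    under eq_fun do rewrite EFinM; exact: integrableZl.
  have iexp : P.-integrable setT (EFin \o (fun w => expR (c * Z w))).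
    apply/integrableP; split; first exact/measurable_EFinP.
    under eq_integral do rewrite /= ger0_norm ?expR_ge0 //.
    by rewrite mgf ltry.
  have i1 : (\int[P]_w (1 + c * Z w)%:E = 1)%E.
    under eq_integral do rewrite EFinD.
    rewrite integralD_EFin //.
    under [X in (_ + X)%E]eq_integral do rewrite /= EFinM.
    rewrite integralZl // (_ : (\int[P]_x (Z x)%:E = 0)%E); last by rewrite -EZ unlock.
    by rewrite mule0 adde0 integral_cst //= probability_setT mul1e.
  rewrite -i1; apply: le_integral => //.
  - under eq_fun do rewrite EFinD; exact: integrableD.
  - by move=> w _; rewrite lee_fin; exact: expR_ge1Dx.
have vv0 : v <= v0.
  apply: le_of_small_quadratic => // a a0.
  pose r := Num.sqrt (1 + 2 * a * v).
  have av : 0 <= a * v by rewrite mulr_ge0 // ltW.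
  have av2 : 1 <= 1 + 2 * a * v by rewrite lerDl -mulrA mulr_ge0.
  have r1 : 1 <= r by rewrite -[leLHS]sqrtr1 ler_wsqrtr.
  have r2 : r ^+ 2 = 1 + 2 * a * v by rewrite sqr_sqrtr // (le_trans _ av2).
  have rle : r <= 1 + a * v.
    rewrite -(@ger0_norm _ (1 + a * v)); last by rewrite addr_ge0.
    by rewrite -sqrtr_sqr ler_wsqrtr // sqrrD expr1n; clear -av; nra.
  have : (1 <= (r^-1 + a * v0)%:E)%E.
    rewrite EFinD -(mgf2 m0) // EFinM -iZ2 -ge0_integralZl_EFin ?(ltW a0) //; last 2 first.
    - by move=> w _; rewrite lee_fin sqr_ge0.
    - by apply/measurable_EFinP; exact: measurable_funX.
    rewrite -ge0_integralD //; last 3 first.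
    - apply/measurable_EFinP; apply: measurableT_comp => //.
      by apply: measurable_funM => //; exact: measurable_funX.
    - by move=> w _; rewrite -EFinM lee_fin mulr_ge0 ?sqr_ge0 // ltW.
    - under eq_fun do rewrite -EFinM.
      by apply/measurable_EFinP; apply: measurable_funM => //; exact: measurable_funX.
    have -> : 1%E = (\int[P]_w (cst 1 w))%E.
      by rewrite integral_cst //= probability_setT mul1e.
    apply: ge0_le_integral_nomeas => [w|w]; first exact: lee01.
    rewrite -EFinM -EFinD lee_fin.
    by have := expR_ge1Dx (- a * Z w ^+ 2); clear; lra.
  rewrite lee_fin => h.
  have r0 : 0 < r by exact: lt_le_trans r1.
  have h' : r <= 1 + a * v0 * r.
    by move: h; rewrite -(ler_pM2r r0) mul1r mulrDl mulVf ?gt_eqF.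
  have h2 : 2 * v <= v0 * r * (r + 1).
    have : (r - 1) * (r + 1) <= a * v0 * r * (r + 1) by rewrite ler_pM2r ?addr_gt0 //; clear -h'; lra.
    have -> : (r - 1) * (r + 1) = a * (2 * v) by rewrite -subr_sqr r2; ring.
    by rewrite -!mulrA ler_pM2l.
  apply: (le_trans h2); rewrite -!mulrA ler_wpM2l // ler_pM ?(ltW r0) ?addr_ge0 ?(ltW r0) //; clear -rle; lra.
have := mgf 1; rewrite m0 mulr0 add0r expr1n mul1r.
under eq_integral do rewrite mul1r.
by move=> ->; rewrite lee_fin ler_expR; clear -vv0; lra.
Qed.

End GaussianMoments.

(** * Chi-square functionals of the white noise *)

Section ChiSquare.
Context {R : realType} (d : measure_display) (T : measurableType d)
  (P : probability T R) (W : (R -> R) -> {RV P >-> R}).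
Local Notation mu := (@leb01 R).
Hypothesis hW : white_noise W.

Lemma white_noise_mgf u : L2 mu u ->
  (\int[P]_w (expR (W u w))%:E <= (expR (ip mu u u / 2))%:E)%E.
Proof.
move=> hu; case: hW => gW EW cW; apply: gaussian_centered_mgf => //.
- have := gW 1%N (fun=> 1) (fun=> u) (fun=> hu).
  by under eq_fun do rewrite big_ord1 mul1r.
- exact: EW.
- exact: cW.
Qed.

Variable V : set (R -> R).
Hypothesis VL2 : V `<=` L2 mu.
Hypothesis Vlin : forall a u v, V u -> V v -> V (fun x => a * u x + v x).
Hypothesis Wlin : {ae P, forall w, linear_on V (fun u => W u w)}.

(** The square in the exponent becomes linear in [x], at the price of an auxiliary
    standard normal variable. *)
Lemma expR_sqr_as_integral (t x : R) : 0 <= t ->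
  ((expR (t * x ^+ 2))%:E =
  \int[lebesgue_measure]_g ((expR (Num.sqrt (2 * t) * x * g))%:E * (normal_pdf 0 1 g)%:E))%E.
Proof.
move=> t0; rewrite integral_expR_normal_pdf ?oner_neq0 //.
rewrite mulr0 add0r expr1n mulr1 exprMn sqr_sqrtr ?mulr_ge0 //.
by congr (expR _)%:E; field.
Qed.

Lemma normal_chi2_mgf (t q : R) : 0 <= t -> 2 * t < 1 -> 0 <= q <= 1 ->
  (\int[lebesgue_measure]_g ((expR (t * q * g ^+ 2))%:E * (normal_pdf 0 1 g)%:E) <=
  ((Num.sqrt (1 - 2 * t))^-1)%:E)%E.
Proof.
move=> t0 t1 /andP[q0 q1].
have tq0 : 0 <= t * q by rewrite mulr_ge0.
have tq : t * q <= t by rewrite ler_piMr.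
have := @integral_expR_sqr_normal_pdf R (- (t * q)) 1 (oner_neq0 _).
rewrite expr1n mulr1 opprK => ->; last by lra.
have h : 0 < 1 - 2 * t by rewrite subr_gt0.
rewrite lee_fin lef_pV2 ?posrE ?sqrtr_gt0 //; last by lra.
by rewrite ler_wsqrtr //; lra.
Qed.

Definition orthogonal_family (us : seq (R -> R)) :=
  pairwise (fun u v => ip mu u v == 0) us.

(** Induction on the family. Each square is replaced by an integral over an auxiliary
    normal variable g, which turns [u] into u + sqrt (2 t) g v; Tonelli exchanges the
    integrals, and orthogonality keeps the new vector orthogonal to the rest. The
    vector [u] makes the statement inductive. Vectors of norm below 1 are allowed, so
    that a possibly null direction can be added to an orthonormal family. *)
Lemma chi2_mgf (t : R) us u : 0 <= t -> 2 * t < 1 ->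
  V u -> (forall v, v \in us -> V v /\ ip mu v v <= 1) ->
  orthogonal_family (u :: us) ->
  (\int[P]_w (expR (W u w + t * \sum_(v <- us) W v w ^+ 2))%:E <=
   ((Num.sqrt (1 - 2 * t))^-1 ^+ size us * expR (ip mu u u / 2))%:E)%E.
Proof.
move=> t0 t1; elim: us u => [|v us IH] u Vu hus orth.
  rewrite expr0 mul1r; under eq_integral do rewrite big_nil mulr0 addr0.
  exact/white_noise_mgf/VL2.
have [Vv v1] : V v /\ ip mu v v <= 1 by apply: hus; rewrite mem_head.
have hus' v' : v' \in us -> V v' /\ ip mu v' v' <= 1.
  by move=> h; apply: hus; rewrite inE h orbT.
have v0 := ip_ge0 mu v.
move: orth; rewrite /orthogonal_family /= => /andP[/andP[uv uus] /andP[vus orth]].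
set c := Num.sqrt (2 * t).
set K := (Num.sqrt (1 - 2 * t))^-1.
have K0 : 0 <= K by rewrite invr_ge0 sqrtr_ge0.
pose S w := \sum_(v <- us) W v w ^+ 2.
have mS : measurable_fun [set: T] S.
  by apply: measurable_sum => v'; exact: measurable_funX.
pose F (p : T * measurableTypeR R) : \bar R :=
  ((expR (W u p.1 + c * W v p.1 * p.2 + t * S p.1))%:E * (normal_pdf 0 1 p.2)%:E)%E.
have F0 p : (0 <= F p)%E.
  by rewrite mule_ge0 // lee_fin ?expR_ge0 ?normal_pdf_ge0.
have mfst (f : T -> R) : measurable_fun [set: T] f ->
    measurable_fun [set: T * measurableTypeR R] (fun p => f p.1).
  by move=> mf; apply: measurableT_comp.
have mF : measurable_fun [set: T * measurableTypeR R] F.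
  apply: emeasurable_funM; apply/measurable_EFinP.
    apply: measurableT_comp => //; apply: measurable_funD.
      apply: measurable_funD; first exact: mfst.
      apply: measurable_funM; last exact: measurable_snd.
      by apply: measurable_funM => //; exact: mfst.
    by apply: measurable_funM => //; exact: mfst.
  exact: (measurableT_comp (measurable_normal_pdf 0 1) measurable_snd).
have -> : (\int[P]_w (expR (W u w + t * \sum_(v <- v :: us) W v w ^+ 2))%:E =
    \int[P]_w \int[@lebesgue_measure R]_g F (w, g))%E.
  apply: eq_integral => w _; rewrite big_cons /F /=.
  have -> : W u w + t * (W v w ^+ 2 + \sum_(v <- us) W v w ^+ 2) =
    (W u w + t * S w) + t * W v w ^+ 2 by rewrite /S; ring.
  rewrite expRD EFinM expR_sqr_as_integral // -ge0_integralZl_EFin ?expR_ge0 //.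
  - apply: eq_integral => g _; rewrite muleA -EFinM -expRD -/c.
    by rewrite EFinM addrAC.
  - by move=> g _; rewrite mule_ge0 // lee_fin ?expR_ge0 ?normal_pdf_ge0.
  - apply: emeasurable_funM; apply/measurable_EFinP.
      by apply: measurableT_comp => //; exact: measurable_funM.
    exact: measurable_normal_pdf.
(* From here on the auxiliary variable g is the outer one. *)
rewrite [leLHS](@fubini_tonelli _ _ _ _ R P lebesgue_measure F mF F0).
apply: (@le_trans _ _ (\int[@lebesgue_measure R]_g
    ((K ^+ size us * expR (ip mu u u / 2))%:E *
      ((expR (t * ip mu v v * g ^+ 2))%:E * (normal_pdf 0 1 g)%:E)))%E).
  apply: ge0_le_integral_nomeas => g.
    by apply: integral_ge0 => w _; exact: F0.
  have Vcg : V (fun x => c * g * v x + u x) by exact: Vlin.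
  have L2v := VL2 Vv; have L2u := VL2 Vu.
  have L2cgv : L2 mu (fun x => c * g * v x) by exact: L2_mulZ.
  have L2u' : L2 mu (fun x => c * g * v x + u x) by exact: L2D.
  rewrite /fubini_G /F /=.
  under eq_integral do rewrite muleC.
  rewrite ge0_integralZl_EFin ?normal_pdf_ge0 //; last first.
    apply/measurable_EFinP; apply: measurableT_comp => //; apply: measurable_funD.
      apply: measurable_funD => //.
      by apply: measurable_funM => //; exact: measurable_funM.
    exact: measurable_funM.
  rewrite muleA muleC; apply: lee_wpmul2r; first by rewrite lee_fin normal_pdf_ge0.
  have orth' : orthogonal_family ((fun x => c * g * v x + u x) :: us).
    rewrite /orthogonal_family /= orth andbT; apply/allP => v' v'us.
    rewrite ipDl ?ipZl //; last 2 first.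
    - by have [/VL2] := hus' _ v'us.
    - by have [/VL2] := hus' _ v'us.
    move/allP: uus => /(_ _ v'us) /eqP ->; move/allP: vus => /(_ _ v'us) /eqP ->.
    by rewrite mulr0 addr0.
  apply: le_trans (le_trans _ (IH _ Vcg hus' orth')) _.
    apply: ae_le_integral_measr.
    - by move=> w; rewrite lee_fin expR_ge0.
    - by move=> w; rewrite lee_fin expR_ge0.
    - apply/measurable_EFinP; apply: measurableT_comp => //; apply: measurable_funD => //.
      exact: measurable_funM.
    - move: Wlin; apply: filterS => w lw; rewrite lw // lee_fin ler_expR /S.
      rewrite le_eqVlt; apply/orP; left; apply/eqP; ring.
  rewrite -EFinM lee_fin -[leRHS]mulrA -expRD ler_wpM2l ?exprn_ge0 // ler_expR.
  rewrite ipDl ?ipZl // ?(ipC mu _ (fun x => c * g * v x + u x)) //.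
  rewrite !ipDl ?ipZl // (ipC mu v u) (eqP uv).
  have c2 : c ^+ 2 = 2 * t by rewrite sqr_sqrtr // mulr_ge0.
  rewrite le_eqVlt; apply/orP; left; apply/eqP.
  have -> : c * g * (c * g * ip mu v v + 0) = c ^+ 2 * g ^+ 2 * ip mu v v by ring.
  by rewrite c2; field.
rewrite ge0_integralZl_EFin ?mulr_ge0 ?exprn_ge0 ?expR_ge0 //; last 2 first.
- by move=> g _; rewrite mule_ge0 // lee_fin ?expR_ge0 ?normal_pdf_ge0.
- apply: emeasurable_funM; apply/measurable_EFinP.
    apply: measurableT_comp => //; apply: measurable_funM => //; exact: measurable_funX.
  exact: measurable_normal_pdf.
have v01 : 0 <= ip mu v v <= 1 by rewrite v0 v1.
apply: le_trans (lee_wpmul2l _ (normal_chi2_mgf t0 t1 v01)) _.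
  by rewrite lee_fin mulr_ge0 ?exprn_ge0 ?expR_ge0.
rewrite -EFinM lee_fin -/K exprS le_eqVlt; apply/orP; left; apply/eqP; ring.
Qed.

(** Chernoff: max(z, 0) <= exp (t z) / t with 1 - 2 t = 1 / l^2, then l <= exp (l - 1). *)
Lemma chi2_excess (l : R) us : 2 <= l -> V (fun=> 0) ->
  (forall v, v \in us -> V v /\ ip mu v v <= 1) ->
  orthogonal_family us ->
  (\int[P]_w (Num.max (\sum_(v <- us) W v w ^+ 2 - l ^+ 2 * (size us)%:R) 0)%:E <=
   (4 * expR (- ((l - 1) ^+ 2 * (size us)%:R / 2)))%:E)%E.
Proof.
move=> l2 V0 hus orth.
pose t := (1 - (l ^+ 2)^-1) / 2.
have l0 : 0 < l by lra.
have l20 : 0 < l ^+ 2 by rewrite exprn_gt0.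
have li : (l ^+ 2)^-1 <= 1 / 4.
  rewrite -[1 / 4]mul1r -[X in _ <= X]divr1 ler_pdivlMr // mulrC -ler_pdivlMr ?invr_gt0 //.
  by rewrite invrK; nra.
have li0 : 0 < (l ^+ 2)^-1 by rewrite invr_gt0.
have t38 : 3 / 8 <= t by rewrite /t; lra.
have t0 : 0 < t by lra.
have t1 : 2 * t < 1 by rewrite /t; lra.
have K : (Num.sqrt (1 - 2 * t))^-1 = l.
  have -> : 1 - 2 * t = (l ^-1) ^+ 2 by rewrite /t exprVn; field; rewrite gt_eqF.
  by rewrite sqrtr_sqr ger0_norm ?invr_ge0 ?ltW // invrK.
set n := size us.
have zero_orth : orthogonal_family ((fun=> 0) :: us).
  rewrite /orthogonal_family /= [pairwise _ _]orth andbT; apply/allP => v vus.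
  by have [/VL2 hv _] := hus _ vus; rewrite ip0l.
have := chi2_mgf (ltW t0) t1 V0 hus zero_orth.
rewrite K ip0l ?mul0r ?expR0 ?mulr1; last exact/VL2.
move=> mgf.
pose S w := \sum_(v <- us) W v w ^+ 2.
have mS : measurable_fun [set: T] S.
  by apply: measurable_sum => v'; exact: measurable_funX.
pose B := t^-1 * expR (- t * (l ^+ 2 * n%:R)).
have B0 : 0 <= B by rewrite mulr_ge0 ?invr_ge0 ?expR_ge0 // ltW.
apply: (@le_trans _ _ (\int[P]_w (B%:E * (expR (W (fun=> 0%R) w + t * S w))%:E))%E).
  apply: ae_le_integral_measr.
  - by move=> w; rewrite lee_fin le_max lexx orbT.
  - by move=> w; rewrite -EFinM lee_fin mulr_ge0 ?expR_ge0.
  - apply: emeasurable_funM => //; apply/measurable_EFinP.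
    by apply: measurableT_comp => //; apply: measurable_funD => //; exact: measurable_funM.
  - move: Wlin; apply: filterS => w lw.
    have W0 : W (fun=> 0) w = 0.
      have := lw 1 _ _ V0 V0.
      have -> : (fun x : R => 1 * 0 + 0) = (fun=> 0 : R) by apply/funext => x; ring.
      lra.
    rewrite W0 add0r -EFinM lee_fin ge_max; apply/andP; split; last first.
      by rewrite mulr_ge0 ?expR_ge0.
    rewrite /B -[leRHS]mulrA -expRD ler_pdivlMl //.
    have := expR_ge1Dx (- t * (l ^+ 2 * n%:R) + t * S w).
    rewrite -/(S w) -/n; nra.
rewrite ge0_integralZl_EFin //; last first.
  apply/measurable_EFinP; apply: measurableT_comp => //.
  by apply: measurable_funD => //; exact: measurable_funM.
apply: le_trans (lee_wpmul2l _ mgf) _; first by rewrite lee_fin.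
rewrite -EFinM lee_fin /B -[leLHS]mulrA.
apply: ler_pM; rewrite ?invr_ge0 ?(ltW t0) ?mulr_ge0 ?expR_ge0 ?exprn_ge0 ?(ltW l0) //.
  rewrite -[4]invrK lef_pV2 ?posrE ?invr_gt0 //; lra.
have le : l <= expR (l - 1) by have := expR_ge1Dx (l - 1); lra.
have le' : l ^+ n <= expR (n%:R * (l - 1)).
  by rewrite expRM_natl; apply: lerXn2r; rewrite ?nnegrE ?expR_ge0 ?(ltW l0).
apply: le_trans (ler_wpM2l (expR_ge0 _) le') _.
rewrite -expRD ler_expR /t.
have -> : - ((1 - (l ^+ 2)^-1) / 2) * (l ^+ 2 * n%:R) = - (l ^+ 2 - 1) * n%:R / 2.
  by field; rewrite gt_eqF.
rewrite le_eqVlt; apply/orP; left; apply/eqP; by field.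
Qed.

End ChiSquare.

(** * Wavelet models and their dimensions *)

Section Models.
Context {R : realType} (phi psi : R -> R) (theta : R).
Local Notation mu := (@leb01 R).
Local Notation e := (Psi phi psi).
Hypothesis eL2 : forall i, Psi_indices i -> L2 mu (e i).
Hypothesis eon : forall i j, Psi_indices i -> Psi_indices j ->
  ip mu (e i) (e j) = (i == j)%:R.
Hypothesis theta_gt2 : 2 < theta.

Definition level_size (J j : nat) : nat :=
  if (j < J)%N then (2 ^ j)%N else Num.truncn (2 ^+ J * (j - J).+1%:R `^ (- theta)).

Lemma level_weight_le1 (l : nat) : (l.+1%:R : R) `^ (- theta) <= 1.
Proof.
rewrite powRN invf_le1 ?powR_gt0 ?ltr0n //.
apply: (@le_trans _ _ (1 `^ theta)); first by rewrite powR1.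
by apply: ge0_ler_powR; rewrite ?nnegrE ?ler1n ?ler0n ?ler01 // (le_trans _ (ltW theta_gt2)).
Qed.

Lemma level_size_le (J j : nat) : (level_size J j <= 2 ^ j)%N.
Proof.
rewrite /level_size; case: ltnP => // Jj.
rewrite -(ler_nat R); apply: (@le_trans _ _ (2 ^+ J)).
  set x := _ * _; apply: (@le_trans _ _ x).
    by rewrite truncn_le mulr_ge0 ?powR_ge0 ?exprn_ge0.
  by rewrite ler_piMr ?exprn_ge0 ?level_weight_le1.
by rewrite natrX ler_weXn2l // ler1n.
Qed.

(** Beyond this level the weight is below 1 and its integer part vanishes, so the
    index sets are finite. *)
Lemma level_size0 (J j : nat) : (J + 2 ^ J <= j)%N -> level_size J j = 0%N.
Proof.
move=> Kj; have Jj : (J <= j)%N by apply: leq_trans Kj; exact: leq_addr.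
rewrite /level_size ltnNge Jj /=; apply/truncn0Pn; rewrite -ltNge.
rewrite powRN ltr_pdivrMr ?powR_gt0 ?ltr0n // mul1r.
apply: (@lt_le_trans _ _ ((j - J).+1%:R)).
  by rewrite -natrX ltr_nat ltnS leq_subRL.
rewrite -[leLHS]powRr1 ?ler0n //; apply: ler_powR; first by rewrite ler1n.
by rewrite (le_trans _ (ltW theta_gt2)) // ler1n.
Qed.

Definition indices (I : set (nat * nat)) : seq (option (nat * nat)) :=
  None :: map Some (fset_set I).

Lemma uniq_indices I : uniq (indices I).
Proof.
rewrite /= map_inj_uniq ?fset_uniq ?andbT; last by move=> ? ? [].
by apply/mapP => -[].
Qed.

Section FiniteIndices.
Variable I : set (nat * nat).
Hypothesis finI : finite_set I.
Hypothesis wI : I `<=` wavelet_indices.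

Lemma mem_indices jk : (Some jk \in indices I) = (jk \in I).
Proof. by rewrite in_cons /= mem_map ?in_fset_set // => ? ? []. Qed.

Lemma set_indices : [set` indices I] = None |` (Some @` I).
Proof.
apply/seteqP; split => [[jk|]|[jk|]] /=.
- by rewrite mem_indices inE => h; right; exists jk.
- by move=> _; left.
- by case=> [//|[jk' h [<-]]]; rewrite mem_indices inE.
- by [].
Qed.

Lemma indices_Psi i : i \in indices I -> Psi_indices i.
Proof.
move=> h; have : [set` indices I] i by [].
by rewrite set_indices => -[->|[jk /wI hjk <-]]; [left|right; exists jk].
Qed.

Lemma model_of_indices : model_of phi psi I = lspan (e @` [set` indices I]).
Proof. by rewrite /model_of set_indices. Qed.

Lemma l2dim_model : l2dim mu (model_of phi psi I) = size (indices I).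
Proof.
rewrite model_of_indices; apply: (l2dim_comb eL2 eon) => //; first exact: uniq_indices.
exact: indices_Psi.
Qed.

End FiniteIndices.

Lemma size_indices_sub I I' : finite_set I' -> I `<=` I' ->
  (size (indices I) <= size (indices I'))%N.
Proof.
move=> finI' sub; have finI := sub_finite_set sub finI'.
rewrite /= !size_map ltnS; apply: uniq_leq_size; first exact: fset_uniq.
by move=> x; rewrite !in_fset_set // !inE; exact: sub.
Qed.

Lemma index_sets_wavelet J I : index_sets theta J I -> I `<=` wavelet_indices.
Proof.
move=> [A [hA ->]] [j k] [[]//|[/= Jj Ak]].
by have [/(_ k Ak)] := hA _ Jj.
Qed.

(** The cardinality is prescribed level by level, so it depends on [J] only. *)
Lemma card_index_sets J I : index_sets theta J I ->
  finite_set I /\ size (indices I) = (\sum_(0 <= j < J + 2 ^ J) level_size J j).+1.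
Proof.
move=> [A [hA IE]].
pose B j := if (j < J)%N then `I_(2 ^ j) else A j.
have Bcard j : (B j #= `I_(level_size J j))%card.
  rewrite /B /level_size; case: ltnP => // Jj; exact: (hA _ Jj).2.
have Bsub j : B j `<=` `I_(2 ^ j).
  by rewrite /B; case: ltnP => [_ ?|Jj] //; exact: (hA _ Jj).1.
have Bfin j : finite_set (B j) by apply/finite_setP; exists (level_size J j).
have IB j k : I (j, k) <-> B j k.
  rewrite IE /B; case: ltnP => Jj; split => /=.
  - by case=> [[]|[]]; rewrite // leqNgt Jj.
  - by move=> h; left.
  - by case=> [[]|[]]; rewrite // ltnNge Jj.
  - by move=> h; right.
pose s := [seq (j, k) | j <- iota 0 (J + 2 ^ J), k <- (fset_set (B j) : seq nat)].
have us : uniq s.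
  apply: allpairs_uniq_dep => [|j _|[j k] [j' k'] _ _ []]; rewrite ?iota_uniq ?fset_uniq //.
  by move=> -> ->.
have ms jk : jk \in s <-> I jk.
  case: jk => j k; rewrite IB; split.
    move=> /allpairsPdep[j' [k' [_ h [-> ->]]]].
    by move: h; rewrite in_fset_set // inE.
  move=> h; apply/allpairsPdep; exists j, k; split => //; last by rewrite in_fset_set // inE.
  rewrite mem_iota /= add0n ltnNge; apply/negP => Kj.
  by have := Bcard j; rewrite level_size0 // II0 card_eq0 => /eqP B0; rewrite B0 in h.
have Is : I = [set` s] by apply/seteqP; split => jk /ms.
have finI : finite_set I by rewrite Is; exact: finite_seq.
split => //; rewrite /= size_map; congr S.
have -> : size (fset_set I) = size s.
  apply/eqP; rewrite -uniq_size_uniq ?fset_uniq // => x.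
  by apply/idP/idP; rewrite in_fset_set // inE => /ms.
rewrite size_allpairs_dep sumnE big_map /index_iota subn0; apply: eq_bigr => j _.
exact: card_fset_set.
Qed.

Lemma index_sets_neq0 J : exists I, index_sets theta J I.
Proof.
pose A j := `I_(Num.truncn (2 ^+ J * (j - J).+1%:R `^ (- theta))).
eexists; exists A; split; last reflexivity.
move=> j Jj; split => // k; rewrite /A /= => h; apply: (leq_trans h).
by have := level_size_le J j; rewrite /level_size ltnNge Jj.
Qed.

Lemma dimJE J I : index_sets theta J I -> dimJ phi psi theta J = size (indices I).
Proof.
move=> hI; rewrite /dimJ; set Q := (X in xget _ X).
have QP I' : index_sets theta J I' -> l2dim mu (model_of phi psi I') = size (indices I).
  move=> hI'; have [fI' sI'] := card_index_sets hI'.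
  rewrite l2dim_model //; last exact: index_sets_wavelet hI'.
  by rewrite sI' (card_index_sets hI).2.
have : Q (xget 0%N Q) by apply: xgetPex; exists (size (indices I)), I => //; rewrite QP.
by case=> I' hI' ->; exact: QP.
Qed.

Lemma dimJ_gt0 J : (0 < dimJ phi psi theta J)%N.
Proof. by have [I /dimJE ->] := index_sets_neq0 J. Qed.

Section Truncation.
Variables (j0 : int) (J : nat) (I : set (nat * nat)).
Hypothesis hI : index_sets theta J I.

Lemma truncate_sub : truncate j0 I `<=` I. Proof. by move=> ? []. Qed.

Lemma finite_truncate : finite_set (truncate j0 I).
Proof. exact: sub_finite_set truncate_sub (card_index_sets hI).1. Qed.

Lemma truncate_wavelet : truncate j0 I `<=` wavelet_indices.
Proof. by move=> x /truncate_sub /(index_sets_wavelet hI). Qed.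

Lemma size_truncate_le : (size (indices (truncate j0 I)) <= dimJ phi psi theta J)%N.
Proof.
by rewrite (dimJE hI); apply: size_indices_sub (card_index_sets hI).1 truncate_sub.
Qed.

End Truncation.

(** Dimensions are natural numbers, so the infimum over the [J] that give the same
    model is a minimum. *)
Lemma penalty_attained (lambda : nat -> R) (j0 : nat -> int) n m :
  0 <= lambda n -> models_upto phi psi theta (j0 n) m ->
  exists2 J, models_upto_from phi psi theta (j0 n) J m &
    penalty phi psi theta lambda j0 n m = lambda n / n%:R * (dimJ phi psi theta J)%:R.
Proof.
move=> l0 [J0 hJ0].
have : exists d, `[< exists2 J, models_upto_from phi psi theta (j0 n) J m &
   dimJ phi psi theta J = d >].
  by exists (dimJ phi psi theta J0); apply/asboolP; exists J0.
move=> /ex_minnP[d /asboolP[J hJ dE] dmin]; exists J => //.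
rewrite /penalty; congr (_ * _); rewrite dE.
set S := (X in inf X); apply/le_anti/andP; split.
  apply: ge_inf; last by exists J => //=; rewrite dE.
  by exists 0 => _ [J' _ <-].
apply: lb_le_inf; first by exists (dimJ phi psi theta J)%:R, J.
move=> _ [J' hJ' <-]; rewrite ler_nat; apply: dmin; apply/asboolP; by exists J'.
Qed.

Lemma penalty_le (lambda : nat -> R) (j0 : nat -> int) n m J :
  0 <= lambda n -> models_upto_from phi psi theta (j0 n) J m ->
  penalty phi psi theta lambda j0 n m <= lambda n / n%:R * (dimJ phi psi theta J)%:R.
Proof.
move=> l0 hJ; rewrite /penalty; apply: ler_wpM2l; first by rewrite divr_ge0.
apply: ge_inf; last by exists J.
by exists 0 => _ [J' _ <-].
Qed.

Lemma finite_models_upto (j0 : int) : finite_set (models_upto phi psi theta j0).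
Proof.
pose K := `|Num.max j0 0|%N.
pose U := [set jk : nat * nat | (jk.1 < K)%N /\ (jk.2 < 2 ^ K)%N].
have finU : finite_set U.
  rewrite (_ : U = `I_K `*` `I_(2 ^ K)); first exact: finite_setX.
  by [].
have -> : models_upto phi psi theta j0 = model_of phi psi @`
   [set I | I `<=` U /\ models_upto phi psi theta j0 (model_of phi psi I)].
  apply/seteqP; split => [m [J [I hI mE]]|_ [I [_ hI] <-] //].
  exists (truncate j0 I) => //; split; last by rewrite -mE; exists J, I.
  move=> [j k] jk; have /= kj := truncate_wavelet hI jk.
  case: jk => _ /= jj0; have jK : (j < K)%N by rewrite /K; lia.
  split => //=; apply: (leq_trans kj); rewrite leq_exp2l //; exact: ltnW.
apply: finite_image.
apply: (@sub_finite_set _ _ ((fun X : {fset nat * nat} => [set` X]) @`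
   [set` fpowerset (fset_set U)])); last exact/finite_image/finite_fset.
move=> I [IU _]; have finI : finite_set I by exact: sub_finite_set IU finU.
exists (fset_set I); last by rewrite fset_setK.
by rewrite /= fpowersetE -fset_set_sub //.
Qed.

End Models.

(** * Comparison of two models in coordinates *)

Section CoordinateInequalities.
Context {R : realType} (I : eqType) (L Lt : seq I).
Hypothesis uL : uniq L.
Hypothesis uLt : uniq Lt.
Variables (b xi : I -> R) (S2 pen pent : R).

Lemma sum_splitL (f : I -> R) : \sum_(i <- L) f i =
  \sum_(i <- L | i \in Lt) f i + \sum_(i <- L | i \notin Lt) f i.
Proof. by rewrite (bigID (mem Lt)). Qed.

Lemma sum_splitLt (f : I -> R) : \sum_(i <- Lt) f i =
  \sum_(i <- L | i \in Lt) f i + \sum_(i <- Lt | i \notin L) f i.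
Proof.
rewrite (bigID (mem L)) /=; congr (_ + _).
rewrite -[LHS]big_filter -[RHS]big_filter; apply: perm_big; apply: uniq_perm; rewrite ?filter_uniq // => x.
by rewrite !mem_filter andbC.
Qed.

Lemma sum_union (f : I -> R) : \sum_(i <- undup (L ++ Lt)) f i =
  \sum_(i <- L | i \in Lt) f i + \sum_(i <- L | i \notin Lt) f i +
  \sum_(i <- Lt | i \notin L) f i.
Proof.
rewrite -sum_splitL -[X in _ = _ + X]big_filter -big_cat /=.
apply: perm_big; apply: uniq_perm; rewrite ?undup_uniq //.
  rewrite cat_uniq uL filter_uniq // andbT /=; apply/hasPn => x.
  by rewrite mem_filter => /andP[].
by move=> x; rewrite mem_undup !mem_cat mem_filter; case: (x \in L).
Qed.

Hypothesis bessel_union : \sum_(i <- undup (L ++ Lt)) b i ^+ 2 <= S2.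
Hypothesis crit :
  - \sum_(i <- Lt) (b i + xi i) ^+ 2 + pent <= - \sum_(i <- L) (b i + xi i) ^+ 2 + pen.

Let bias (K : seq I) := S2 - \sum_(i <- K) b i ^+ 2.
Let loss := bias Lt + \sum_(i <- Lt) xi i ^+ 2.

(** The common coordinates cancel, the gain of [Lt] on its own coordinates is at most
    2 sum b^2 + 2 sum xi^2, and these sums are parts of the bias of [L] and of the
    loss of [Lt]. *)
Lemma selected_penalty_le : pent <= pen + 2 * bias L + 2 * loss.
Proof.
move: bessel_union crit; rewrite /loss /bias.
rewrite !(sum_splitL, sum_splitLt, sum_union).
have h1 : \sum_(i <- Lt | i \notin L) (b i + xi i) ^+ 2 <=
    2 * \sum_(i <- Lt | i \notin L) b i ^+ 2 + 2 * \sum_(i <- Lt | i \notin L) xi i ^+ 2.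
  rewrite !mulr_sumr -big_split /=; apply: ler_sum => i _; by have := sqr_ge0 (b i - xi i); rewrite !sqrrD ?sqrrB; lra.
have h2 : 0 <= \sum_(i <- L | i \notin Lt) (b i + xi i) ^+ 2.
  by apply: sumr_ge0 => i _; exact: sqr_ge0.
have h3 : 0 <= \sum_(i <- L | i \in Lt) xi i ^+ 2.
  by apply: sumr_ge0 => i _; exact: sqr_ge0.
have h4 : 0 <= \sum_(i <- L | i \notin Lt) b i ^+ 2.
  by apply: sumr_ge0 => i _; exact: sqr_ge0.
lra.
Qed.

(** Young's inequality with weight [kappa] on the cross terms between the noise and
    the error of [Lt] relative to the projection of the signal on [L]. The whole
    noise seen by this error is the noise of [Lt] and one more Gaussian variable
    [N], along the part of the signal that [L] keeps and [Lt] misses ([nv] is its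
    norm). Keeping the two in one chi-square is what allows a penalty constant
    arbitrarily close to 1. *)
Lemma oracle_inequality (kappa nv N : R) : 1 < kappa ->
  nv ^+ 2 = \sum_(i <- L | i \notin Lt) b i ^+ 2 ->
  nv * N = \sum_(i <- L | i \notin Lt) b i * xi i ->
  loss * ((kappa - 1) / (2 * kappa)) <=
  (1 + (kappa + 1) / (kappa * (kappa - 1))) * bias L + pen +
  kappa * (\sum_(i <- Lt) xi i ^+ 2 + N ^+ 2) - pent.
Proof.
move=> k1 nv2 nvN; move: bessel_union crit; rewrite /loss /bias.
rewrite !(sum_splitL, sum_splitLt, sum_union).
set c2 := (kappa + 1) / _.
pose c1 := (kappa + 1) / (2 * kappa).
have k0 : 0 < kappa by lra.
have -> : (kappa - 1) / (2 * kappa) = 1 - c1 by rewrite /c1; field; rewrite gt_eqF.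
have c1_ge : 0 <= c1 by rewrite divr_ge0; lra.
have c2_ge : 0 <= c2 by rewrite divr_ge0 ?mulr_ge0; lra.
pose ki := kappa^-1.
have ki0 : 0 < ki by rewrite invr_gt0.
have kki : kappa * ki = 1 by rewrite divff // gt_eqF.
have young x y : 2 * x * y <= ki * x ^+ 2 + kappa * y ^+ 2.
  have := sqr_ge0 (x - kappa * y); have -> : (x - kappa * y) ^+ 2 =
    kappa * (ki * x ^+ 2 + kappa * y ^+ 2 - 2 * x * y).
    have -> : kappa * (ki * x ^+ 2 + kappa * y ^+ 2 - 2 * x * y) =
      (kappa * ki) * x ^+ 2 + kappa ^+ 2 * y ^+ 2 - 2 * kappa * x * y by ring.
    by rewrite kki; ring.
  by rewrite pmulr_rge0 // subr_ge0.
have split x y : ki * (x + y) ^+ 2 <= c1 * x ^+ 2 + c2 * y ^+ 2.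
  (* With this weight, ki * (1 + t) = (kappa + 1) / (2 * kappa) is below 1. *)
  pose t := (kappa - 1) / 2.
  have t0 : 0 < t by rewrite divr_gt0; lra.
  have E1 : c1 = ki * (1 + t) by rewrite /c1 /ki /t; field; rewrite gt_eqF.
  have E2 : c2 = ki * (1 + t^-1).
    by rewrite /c2 /ki /t; field; apply/andP; split; apply/eqP; lra.
  rewrite E1 E2 -!mulrA -mulrDr ler_pM2l //.
  have := sqr_ge0 (t * x - y).
  have -> : (t * x - y) ^+ 2 =
    t * ((1 + t) * x ^+ 2 + (1 + t^-1) * y ^+ 2 - (x + y) ^+ 2).
    by field; rewrite gt_eqF.
  by rewrite pmulr_rge0 // subr_ge0.
have hT : 2 * \sum_(i <- Lt | i \notin L) xi i ^+ 2 +
   (\sum_(i <- Lt | i \notin L) (b i + xi i) ^+ 2 -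
    \sum_(i <- Lt | i \notin L) b i ^+ 2 - \sum_(i <- Lt | i \notin L) xi i ^+ 2) <=
   (c1 + kappa) * \sum_(i <- Lt | i \notin L) xi i ^+ 2 +
   c2 * \sum_(i <- Lt | i \notin L) b i ^+ 2.
  rewrite !mulr_sumr -!sumrB -!big_split /=; apply: ler_sum => i _.
  have := young (xi i + b i) (xi i); have := split (xi i) (b i).
  have -> : 2 * (xi i + b i) * xi i =
    2 * xi i ^+ 2 + ((b i + xi i) ^+ 2 - b i ^+ 2 - xi i ^+ 2) by ring.
  lra.
have hL : \sum_(i <- L | i \notin Lt) (b i + xi i) ^+ 2 =
  nv ^+ 2 + 2 * (nv * N) + \sum_(i <- L | i \notin Lt) xi i ^+ 2.
  rewrite nv2 nvN mulr_sumr -!big_split /=; apply: eq_bigr => i _; ring.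
have hLx : 0 <= \sum_(i <- L | i \notin Lt) xi i ^+ 2.
  by apply: sumr_ge0 => i _; exact: sqr_ge0.
have hBx : 0 <= \sum_(i <- L | i \in Lt) xi i ^+ 2.
  by apply: sumr_ge0 => i _; exact: sqr_ge0.
have hN : - (2 * (nv * N)) <= c1 * nv ^+ 2 + kappa * N ^+ 2.
  have := young (- nv) N; have := split (- nv) 0.
  rewrite addr0 expr0n /= mulr0 addr0 sqrrN; nra.
rewrite hL -nv2.
have k2 : 1 <= c1 + kappa.
  by lra.
set B := \sum_(i <- L | i \in Lt) b i ^+ 2; set C := \sum_(i <- L | i \in Lt) (b i + xi i) ^+ 2.
move: hT hLx hBx.
set D1 := \sum_(i <- Lt | i \notin L) (b i + xi i) ^+ 2.
set D2 := \sum_(i <- Lt | i \notin L) b i ^+ 2.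
set D3 := \sum_(i <- Lt | i \notin L) xi i ^+ 2.
set X := \sum_(i <- L | i \in Lt) xi i ^+ 2.
set Y := \sum_(i <- L | i \notin Lt) xi i ^+ 2.
move=> hT hLx hBx hbes hcrit.
have p1 : 0 <= c1 * (S2 - (B + D2) - nv ^+ 2) by rewrite mulr_ge0 //; lra.
have p2 : 0 <= c2 * (S2 - (B + nv ^+ 2) - D2) by rewrite mulr_ge0 //; lra.
have p3 : 0 <= (c1 + kappa - 1) * X by rewrite mulr_ge0 //; lra.
lra.
Qed.

End CoordinateInequalities.


(** * Loss of the selected estimator *)

Lemma ler_sum_sub (R : realType) (I : eqType) (L L' : seq I) (f : I -> R) :
  uniq L -> uniq L' -> {subset L <= L'} -> (forall i, 0 <= f i) ->
  \sum_(i <- L) f i <= \sum_(i <- L') f i.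
Proof.
move=> uL uL' sub f0; rewrite [leRHS](bigID (mem L)) /= -[X in _ <= X + _]big_filter.
rewrite [X in _ <= X + _](perm_big L) /=; first by rewrite lerDl sumr_ge0.
apply: uniq_perm; rewrite ?filter_uniq // => x; rewrite mem_filter.
by case: (boolP (x \in L)) => // /sub.
Qed.

Section Risk.
Context {R : realType} (phi psi : R -> R) (theta : R).
Local Notation mu := (@leb01 R).
Local Notation e := (Psi phi psi).
Hypothesis eL2 : forall i, Psi_indices i -> L2 mu (e i).
Hypothesis eon : forall i j, Psi_indices i -> Psi_indices j ->
  ip mu (e i) (e j) = (i == j)%:R.
Hypothesis theta_gt2 : 2 < theta.
Context (d : measure_display) (T : measurableType d)
  (P : probability T R) (W : (R -> R) -> {RV P >-> R}).
Hypothesis hW : white_noise W.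
Local Notation V := (lspan (e @` Psi_indices)).
Hypothesis hWlin : {ae P, forall w, linear_on V (fun u => W u w)}.
Context (lambda : nat -> R) (j0 : nat -> int)
  (mt : nat -> ((R -> R) -> R) -> set (R -> R)).
Hypothesis lambda_gt0 : forall n, (0 < n)%N -> 0 < lambda n.
Hypothesis hmt : selection_rule phi psi theta lambda j0 mt.

Local Notation b s := (fun i => ip mu s (e i)).
Local Notation xi n w := (fun i => W (e i) w / Num.sqrt n%:R).
Local Notation D := (dimJ phi psi theta).

Definition squared_bias (s : R -> R) (L : seq (option (nat * nat))) : R :=
  ip mu s s - \sum_(i <- L) ip mu s (e i) ^+ 2.

Definition squared_loss s n w : R :=
  nrm mu (shat (data W s n w) (mt n (data W s n w)) \- s) ^+ 2.

Lemma V_L2 : V `<=` L2 mu.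
Proof. by apply: lspan_L2 => _ [i hi <-]; exact: eL2. Qed.

Lemma bias_ge0 s L : L2 mu s -> uniq L -> (forall i, i \in L -> Psi_indices i) ->
  0 <= squared_bias s L.
Proof. by move=> hs uL LD; rewrite subr_ge0; exact: (bessel eL2 eon uL LD hs). Qed.

Lemma bias_sub s L L' : uniq L -> uniq L' -> {subset L <= L'} -> squared_bias s L' <= squared_bias s L.
Proof.
move=> uL uL' sub; rewrite lerD2l lerN2; apply: ler_sum_sub => // i; exact: sqr_ge0.
Qed.

Lemma linear_data s n w : L2 mu s -> linear_on V (fun u => W u w) ->
  linear_on V (data W s n w).
Proof.
move=> hs lw a u v Vu Vv; rewrite /data lw //.
have hu := V_L2 Vu; have hv := V_L2 Vv.
rewrite ipC ipDl ?ipZl //; last exact: L2_mulZ.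
by rewrite (ipC _ u) (ipC _ v); ring.
Qed.

Section Model.
Variables (s : R -> R) (n : nat) (w : T) (I : set (nat * nat)).
Hypothesis hs : L2 mu s.
Hypothesis lw : linear_on V (fun u => W u w).
Hypothesis finI : finite_set I.
Hypothesis wI : I `<=` wavelet_indices.

Lemma loss_model :
  nrm mu (shat (data W s n w) (model_of phi psi I) \- s) ^+ 2 =
  squared_bias s (indices I) + \sum_(i <- indices I) xi n w i ^+ 2.
Proof.
have uI := uniq_indices I; have ID := indices_Psi finI wI.
rewrite model_of_indices // (shat_comb eL2 eon uI ID (linear_data n hs lw)).
rewrite (nrm_comb_sub eL2 eon uI ID) //; congr (_ + _).
by apply: eq_bigr => i _; rewrite /data addrAC subrr add0r.
Qed.

Lemma contrast_model :
  contrast (data W s n w) (shat (data W s n w) (model_of phi psi I)) =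
  - \sum_(i <- indices I) (b s i + xi n w i) ^+ 2.
Proof.
have uI := uniq_indices I; have ID := indices_Psi finI wI.
by rewrite model_of_indices // (contrast_shat eL2 eon uI ID (linear_data n hs lw)).
Qed.

End Model.

(** The model is compared through any finite index set [I] that spans it. *)
Lemma selected_model s n w : (0 < n)%N -> L2 mu s ->
  linear_on V (fun u => W u w) ->
  let m := mt n (data W s n w) in
  exists2 J, models_upto_from phi psi theta (j0 n) J m &
  forall I, finite_set I -> I `<=` wavelet_indices -> m = model_of phi psi I ->
  forall J' I', index_sets theta J' I' ->
  - \sum_(i <- indices I) (b s i + xi n w i) ^+ 2 + lambda n / n%:R * (D J)%:R <=
  - \sum_(i <- indices (truncate (j0 n) I')) (b s i + xi n w i) ^+ 2 +
    lambda n / n%:R * (D J')%:R.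
Proof.
move=> n0 hs lw m; have [mM mmin] := hmt n0 (linear_data n hs lw).
have l0 := ltW (lambda_gt0 n0).
have [J hJ pE] := penalty_attained l0 mM.
exists J => // I finI wI mI J' I' hI'.
have hm' : models_upto_from phi psi theta (j0 n) J' (model_of phi psi (truncate (j0 n) I')).
  by exists I'.
have := mmin _ (ex_intro _ J' hm').
rewrite pE -/m {1}mI !contrast_model //.
- move=> h; apply: (le_trans h); rewrite lerD2l; exact: penalty_le.
- exact: finite_truncate hI'.
- exact: truncate_wavelet hI'.
Qed.

Lemma expectation_loss s n :
  ('E_P[(fun w => nrm mu (shat (data W s n w) (mt n (data W s n w)) \- s) ^+ 2)%R] =
   \int[P]_w (squared_loss s n w)%:E)%E.
Proof. by rewrite unlock. Qed.

(** If the loss exceeded 2 v almost surely, so would the risk. *)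
Lemma risk_selects s n (v : R) : (0 < n)%N -> L2 mu s -> 0 < v ->
  (\int[P]_w (squared_loss s n w)%:E <= v%:E)%E ->
  exists J I, [/\ index_sets theta J I,
    squared_bias s (indices (truncate (j0 n) I)) <= 2 * v
  & forall J' I', index_sets theta J' I' ->
      lambda n / n%:R * (D J)%:R <= lambda n / n%:R * (D J')%:R +
        2 * squared_bias s (indices (truncate (j0 n) I')) + 4 * v].
Proof.
move=> n0 hs v0 hrisk.
have [w [lw lossw]] : exists w, linear_on V (fun u => W u w) /\ squared_loss s n w <= 2 * v.
  apply: contrapT => hno.
  have : (\int[P]_w (2 * v)%:E <= \int[P]_w (squared_loss s n w)%:E)%E.
    apply: ae_le_integral_measl.
    - by move=> w; rewrite lee_fin mulr_ge0 // ltW.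
    - by move=> w; rewrite lee_fin sqr_ge0.
    - exact: measurable_cst.
    - move: hWlin; apply: filterS => w lw; rewrite lee_fin leNgt; apply/negP => h.
      by apply: hno; exists w; split => //; exact: ltW.
  rewrite integral_cst //= probability_setT mule1 => h.
  have := le_trans h hrisk; rewrite lee_fin; nra.
have [J [I hI mI] hsel] := selected_model n0 hs lw.
have fI := finite_truncate theta_gt2 (j0 n) hI; have sI := @truncate_wavelet _ _ (j0 n) _ _ hI.
have crit := hsel _ fI sI mI.
have lossE : squared_loss s n w = squared_bias s (indices (truncate (j0 n) I)) +
    \sum_(i <- indices (truncate (j0 n) I)) xi n w i ^+ 2.
  by rewrite /squared_loss mI loss_model.
exists J, I; split => //.
  apply: le_trans lossw; rewrite lossE lerDl sumr_ge0 // => i _; exact: sqr_ge0.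
move=> J' I' hI'.
have fI' := finite_truncate theta_gt2 (j0 n) hI'; have sI' := @truncate_wavelet _ _ (j0 n) _ _ hI'.
have := @selected_penalty_le R _ (indices (truncate (j0 n) I'))
  (indices (truncate (j0 n) I)) (uniq_indices _) (uniq_indices _) (b s) (xi n w) (ip mu s s)
  (lambda n / n%:R * (D J')%:R) (lambda n / n%:R * (D J)%:R).
have hU : \sum_(i <- undup (indices (truncate (j0 n) I') ++ indices (truncate (j0 n) I)))
    b s i ^+ 2 <= ip mu s s.
  apply: (bessel eL2 eon) => //; first exact: undup_uniq.
  by move=> i; rewrite mem_undup mem_cat => /orP[]; exact: indices_Psi.
move=> /(_ hU (crit _ _ hI')); rewrite -/(squared_bias _ _) -/(squared_bias _ _) -lossE; lra.
Qed.

End Risk.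

(** * Oracle inequality *)

Section UpperRisk.
Context {R : realType} (phi psi : R -> R) (theta : R).
Local Notation mu := (@leb01 R).
Local Notation e := (Psi phi psi).
Hypothesis eL2 : forall i, Psi_indices i -> L2 mu (e i).
Hypothesis eon : forall i j, Psi_indices i -> Psi_indices j ->
  ip mu (e i) (e j) = (i == j)%:R.
Hypothesis theta_gt2 : 2 < theta.
Context (d : measure_display) (T : measurableType d)
  (P : probability T R) (W : (R -> R) -> {RV P >-> R}).
Hypothesis hW : white_noise W.
Local Notation V := (lspan (e @` Psi_indices)).
Hypothesis hWlin : {ae P, forall w, linear_on V (fun u => W u w)}.
Context (lambda : nat -> R) (j0 : nat -> int)
  (mt : nat -> ((R -> R) -> R) -> set (R -> R)).
Hypothesis lambda_gt0 : forall n, (0 < n)%N -> 0 < lambda n.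
Hypothesis hmt : selection_rule phi psi theta lambda j0 mt.

Local Notation b s := (fun i => ip mu s (e i)).
Local Notation xi n w := (fun i => W (e i) w / Num.sqrt n%:R).
Local Notation D := (dimJ phi psi theta).


Local Notation bias := (squared_bias phi psi).
Local Notation loss := (squared_loss W mt).

(** The part of the signal that [L'] keeps and [L] misses, normalized. Since 0^-1 = 0
    it is the null function when nothing is missed. *)
Definition residual_direction s (L' L : seq (option (nat * nat))) : R -> R :=
  let K := [seq i <- L' | i \notin L] in
  let nv := Num.sqrt (\sum_(i <- K) b s i ^+ 2) in
  comb e K (fun i => nv^-1 * b s i).

Definition noise_family s L' L := residual_direction s L' L :: map e L.

Section NoiseFamily.
Variables (s : R -> R) (L' L : seq (option (nat * nat))).

Hypothesis uL' : uniq L'.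
Hypothesis LD' : forall i, i \in L' -> Psi_indices i.
Hypothesis uL : uniq L.
Hypothesis LD : forall i, i \in L -> Psi_indices i.

Let K := [seq i <- L' | i \notin L].
Let nv := Num.sqrt (\sum_(i <- K) b s i ^+ 2).

Let uK : uniq K. Proof. exact: filter_uniq. Qed.
Let KD i : i \in K -> Psi_indices i.
Proof. by rewrite mem_filter => /andP[_ /LD']. Qed.

Let nv2 : nv ^+ 2 = \sum_(i <- K) b s i ^+ 2.
Proof. by rewrite sqr_sqrtr //; apply: sumr_ge0 => i _; exact: sqr_ge0. Qed.

Lemma residual_norm2 : nv ^+ 2 = \sum_(i <- L' | i \notin L) b s i ^+ 2.
Proof. by rewrite nv2 big_filter. Qed.

Lemma residual_noise n w : linear_on V (fun u => W u w) ->
  nv * (W (residual_direction s L' L) w / Num.sqrt n%:R) =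
  \sum_(i <- L' | i \notin L) b s i * xi n w i.
Proof.
move=> lw; rewrite /residual_direction -/K -/nv.
rewrite (linear_on_comb uK KD lw) -[RHS]big_filter -/K.
have -> : \sum_(i <- K) nv^-1 * b s i * W (e i) w =
    nv^-1 * \sum_(i <- K) b s i * W (e i) w.
  by rewrite mulr_sumr; apply: eq_bigr => i _; rewrite mulrA.
have [nv0|nv0] := eqVneq nv 0; last first.
  by rewrite mulrA mulrA divff // mul1r mulr_suml; apply: eq_bigr => i _; rewrite mulrA.
have : nv ^+ 2 = 0 by rewrite nv0 expr0n.
rewrite nv2 => /eqP.
rewrite psumr_eq0 => [/allP h|i _]; last exact: sqr_ge0.
rewrite nv0 mul0r big_seq big1 // => i iK.
by have := h i iK; rewrite sqrf_eq0 => /eqP ->; rewrite mul0r.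
Qed.

Lemma noise_family_unit v : v \in noise_family s L' L -> V v /\ ip mu v v <= 1.
Proof.
rewrite inE => /orP[/eqP ->|/mapP[i iL ->]]; last first.
  have Di := LD iL; rewrite eon // eqxx; split => //.
  exists 1%N, (fun=> 1), (fun=> e i); split=> [_|]; first by exists i.
  by apply/funext => x; rewrite big_ord1 mul1r.
split; first exact: comb_in_span uK KD _.
rewrite /residual_direction -/K -/nv (ip_comb2 eL2 eon uK KD).
have -> : \sum_(i <- K) (nv^-1 * b s i) * (nv^-1 * b s i) = nv^-1 ^+ 2 * nv ^+ 2.
  rewrite nv2 mulr_sumr.
  by apply: eq_bigr => i _; ring.
have [->|nv0] := eqVneq nv 0; first by rewrite expr0n mulr0.
by rewrite exprVn mulVf // expf_neq0.
Qed.

Lemma noise_family_orthogonal : orthogonal_family (noise_family s L' L).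
Proof.
rewrite /orthogonal_family /=; apply/andP; split.
  apply/allP => _ /mapP[i iL ->].
  rewrite (ip_comb_coord eL2 eon uK KD) //; last exact: LD.
  by rewrite mem_filter iL.
rewrite pairwise_map.
apply: (sub_in_pairwise (P := [in L]) (r := [rel x y | x != y])); last first.
- by rewrite -uniq_pairwise.
- by apply/allP.
- move=> i j /= iL jL ij; rewrite eon ?(negbTE ij) //; exact: LD.
Qed.

End NoiseFamily.

(** The noise of the selected model is bounded by the sum over all models of the
    excesses of their chi-squares over l^2 times the dimension plus one. The choice
    of [l] makes that threshold, after division by n, equal to
    (lambda n / n) / kappa times the dimension plus one, so the penalty absorbs it up
    to one term lambda n / n. *)
Lemma oracle_risk s n kappa J' I' : (0 < n)%N -> L2 mu s -> 1 < kappa ->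
  let l := Num.sqrt (kappa^-1 * lambda n) in
  2 <= l ->
  (\esum_(m in models_upto phi psi theta (j0 n))
     (expR (- ((l - 1) ^+ 2 * (l2dim mu m)%:R / 2)))%:E <= 1)%E ->
  index_sets theta J' I' ->
  (\int[P]_w (loss s n w)%:E <=
    (2 * kappa / (kappa - 1) * ((1 + (kappa + 1) / (kappa * (kappa - 1))) *
      bias s (indices (truncate (j0 n) I')) +
      lambda n / n%:R * (D J')%:R + lambda n / n%:R + 4 * kappa / n%:R))%:E)%E.
Proof.
move=> n0 hs k1 l l2 hsum hI'.
have l0 := lambda_gt0 n0.
have nR : 0 < n%:R :> R by rewrite ltr0n.
have k0 : 0 < kappa by exact: lt_trans k1.
have lsq : l ^+ 2 = kappa^-1 * lambda n.
  by rewrite sqr_sqrtr // mulr_ge0 ?invr_ge0 // ltW.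
set L' := indices (truncate (j0 n) I').
have fI' := finite_truncate theta_gt2 (j0 n) hI'.
have sI' := @truncate_wavelet _ _ (j0 n) _ _ hI'.
have uL' : uniq L' := uniq_indices _.
have LD' : forall i, i \in L' -> Psi_indices i := indices_Psi fI' sI'.
have /choice[idx idxP] : forall m, exists I, models_upto phi psi theta (j0 n) m ->
    [/\ finite_set I, I `<=` wavelet_indices & m = model_of phi psi I].
  move=> m; have [[J [I hI mE]]|no] := pselect (models_upto phi psi theta (j0 n) m).
    exists (truncate (j0 n) I) => _; split => //.
      exact: finite_truncate hI.
    exact: truncate_wavelet hI.
  by exists set0 => /no.
pose Lm m := indices (idx m).
pose chi m w := \sum_(v <- noise_family s L' (Lm m)) W v w ^+ 2.
pose ex m w := Num.max (chi m w - l ^+ 2 * (size (Lm m)).+1%:R) 0.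
pose Ms := fset_set (models_upto phi psi theta (j0 n)).
have finM := finite_models_upto phi psi theta_gt2 (j0 n).
have MsP m : m \in Ms -> models_upto phi psi theta (j0 n) m.
  by rewrite in_fset_set // inE.
pose C1 := 2 * kappa / (kappa - 1).
have C10 : 0 < C1 by rewrite divr_gt0 ?mulr_gt0 // subr_gt0.
pose C2 := 1 + (kappa + 1) / (kappa * (kappa - 1)).
pose A := C1 * (C2 * bias s L' + lambda n / n%:R * (D J')%:R + lambda n / n%:R).
pose B := C1 * (kappa / n%:R).
have B0 : 0 <= B by exact/ltW/(mulr_gt0 C10)/divr_gt0.
have C20 : 0 <= C2.
  have km : 0 < kappa - 1 by rewrite subr_gt0.
  apply: addr_ge0 => //; apply/ltW/divr_gt0; last exact: mulr_gt0.
  exact: addr_gt0.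
have x0 : 0 <= lambda n / n%:R by exact/ltW/divr_gt0.
have A0 : 0 <= A.
  apply: mulr_ge0 (ltW C10) _; apply: addr_ge0 (x0); apply: addr_ge0.
    by apply: mulr_ge0 (C20) _; exact: (bias_ge0 eL2 eon).
  exact: (mulr_ge0 x0 (ler0n _ _)).
have ex0 m w : 0 <= ex m w by rewrite le_max lexx orbT.
have mex m : measurable_fun [set: T] (ex m).
  apply: measurable_maxr; last exact: measurable_cst.
  apply: measurable_funB => //.
  by apply: measurable_sum => v; exact: measurable_funX.
have intex m : m \in Ms -> (\int[P]_w (ex m w)%:E <=
    4%:E * (expR (- ((l - 1) ^+ 2 * (l2dim mu m)%:R / 2)))%:E)%E.
  move=> /MsP/idxP[fI sI mE].
  have uL : uniq (Lm m) := uniq_indices _.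
  have LD : forall i, i \in Lm m -> Psi_indices i := indices_Psi fI sI.
  have VL2 : V `<=` L2 mu := @V_L2 _ _ _ eL2.
  have := chi2_excess hW VL2 (@lspan_lin _ _) hWlin l2 (lspan_0 _)
    (noise_family_unit uL' LD' LD) (noise_family_orthogonal s uL' LD' uL LD).
  rewrite /= size_map => h; apply: le_trans h _.
  rewrite -EFinM lee_fin ler_pM2l // ler_expR lerN2 ler_pM2r ?invr_gt0 //.
  apply: ler_wpM2l; first exact: sqr_ge0.
  have -> : l2dim mu m = size (Lm m) by rewrite {1}mE (l2dim_model eL2 eon fI sI).
  by rewrite ler_nat leqnSn.
apply: (@le_trans _ _ (\int[P]_w (A%:E + B%:E * (\sum_(m <- Ms) (ex m w)%:E)))%E).
  apply: ae_le_integral_measr.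
  - by move=> w; rewrite lee_fin sqr_ge0.
  - move=> w; rewrite adde_ge0 ?mule_ge0 ?lee_fin // sume_ge0 // => m _.
    by rewrite lee_fin.
  - apply: emeasurable_funD; first exact: measurable_cst.
    apply: emeasurable_funM; first exact: measurable_cst.
    by apply: emeasurable_sum => m; apply/measurable_EFinP.
  - move: hWlin; apply: filterS => w lw.
    have [J hJ hsel] := selected_model eL2 eon theta_gt2 lambda_gt0 hmt n0 hs lw.
    rewrite /squared_loss; set m := mt n (data W s n w) in hJ hsel *.
    have mM : models_upto phi psi theta (j0 n) m by exists J.
    have mMs : m \in Ms by rewrite in_fset_set // inE.
    have [fI sI mE] := idxP _ mM.
    have uL : uniq (Lm m) := uniq_indices _.
    have LD : forall i, i \in Lm m -> Psi_indices i := indices_Psi fI sI.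
    rewrite {1}mE (loss_model eL2 eon n hs lw fI sI) -/(Lm m).
    have crit := hsel _ fI sI mE _ _ hI'.
    rewrite sumEFin -EFinM -EFinD lee_fin.
    have DJ : ((size (Lm m))%:R : R) <= (D J)%:R.
      rewrite ler_nat -[size _](l2dim_model eL2 eon fI sI) -mE.
      have [I hI ->] := hJ.
      rewrite (l2dim_model eL2 eon); first exact: size_truncate_le hI.
        exact: finite_truncate hI.
      exact: truncate_wavelet hI.
    have hU : \sum_(i <- undup (L' ++ Lm m)) b s i ^+ 2 <= ip mu s s.
      apply: (bessel eL2 eon) => //; first exact: undup_uniq.
      by move=> i; rewrite mem_undup mem_cat => /orP[/LD'|/LD].
    have := oracle_inequality uL' uL hU crit k1 (residual_norm2 s L' (Lm m))
      (residual_noise s (Lm m) uL' LD' n lw).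
    rewrite -/(bias _ _) -/(bias _ _).
    set F := bias s (Lm m) + _.
    set N := W _ w / _.
    have -> : \sum_(i <- Lm m) xi n w i ^+ 2 + N ^+ 2 = chi m w / n%:R.
      rewrite /chi /noise_family [X in _ = X / _]big_cons [X in _ = (_ + X) / _]big_map.
      rewrite addrC [RHS]mulrDl /N expr_div_n sqr_sqrtr // ?ler0n //.
      congr (_ + _); rewrite mulr_suml; apply: eq_bigr => i _.
      by rewrite expr_div_n sqr_sqrtr // ler0n.
    have F1 : F = C1 * (F * ((kappa - 1) / (2 * kappa))).
      rewrite /C1; field; rewrite gt_eqF //= subr_eq0 gt_eqF //.
    rewrite -/C2 => h.
    have hchi : kappa * (chi m w / n%:R) <=
        kappa / n%:R * ex m w + lambda n / n%:R * (size (Lm m)).+1%:R.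
      have : chi m w <= ex m w + l ^+ 2 * (size (Lm m)).+1%:R.
        by rewrite -lerBlDr le_max lexx.
      rewrite lsq => h1.
      have -> : kappa * (chi m w / n%:R) = kappa / n%:R * chi m w by ring.
      apply: (le_trans (ler_wpM2l _ h1)); first by rewrite divr_ge0 // ltW.
      rewrite mulrDr lerD2l le_eqVlt; apply/orP; left; apply/eqP.
      by field; rewrite !gt_eqF.
    have hex : ex m w <= \sum_(m <- Ms) ex m w.
      by rewrite (bigD1_seq m) ?fset_uniq //= lerDl sumr_ge0.
    have hD : lambda n / n%:R * (size (Lm m)).+1%:R <=
        lambda n / n%:R * (D J)%:R + lambda n / n%:R.
      by rewrite -natr1 mulrDr mulr1 lerD2r ler_wpM2l.
    have hk : kappa / n%:R * ex m w <= kappa / n%:R * \sum_(m <- Ms) ex m w.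
      by apply: ler_wpM2l hex; rewrite divr_ge0 // ltW.
    have -> : A + B * \sum_(m <- Ms) ex m w = C1 * (C2 * bias s L' +
        lambda n / n%:R * (D J')%:R + lambda n / n%:R +
        kappa / n%:R * \sum_(m <- Ms) ex m w) by rewrite /A /B; ring.
    rewrite F1 ler_pM2l //.
    move: h hchi hD hk; lra.
rewrite ge0_integralD //; last 2 first.
- by move=> w _; rewrite mule_ge0 ?lee_fin // sume_ge0 // => m _; rewrite lee_fin.
- apply: emeasurable_funM; first exact: measurable_cst.
  by apply: emeasurable_sum => m; apply/measurable_EFinP.
rewrite integral_cst //= probability_setT mule1.
rewrite ge0_integralZl_EFin //; last 2 first.
- by move=> w _; rewrite sume_ge0 // => m _; rewrite lee_fin.
- by apply: emeasurable_sum => m; apply/measurable_EFinP.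
rewrite ge0_integral_sum //; last 2 first.
- by move=> m; apply/measurable_EFinP.
- by move=> m w _; rewrite lee_fin.
have S4 : (\sum_(m <- Ms) \int[P]_w (ex m w)%:E <= 4%:E)%E.
  apply: (@le_trans _ _ (\sum_(m <- Ms)
      4%:E * (expR (- ((l - 1) ^+ 2 * (l2dim mu m)%:R / 2)))%:E)%E).
    rewrite big_seq [leRHS]big_seq; apply: lee_sum => m; exact: intex.
  rewrite -ge0_sume_distrr; last by move=> m _; rewrite lee_fin expR_ge0.
  rewrite -[leRHS]mule1; apply: lee_wpmul2l; first by rewrite lee_fin.
  apply: le_trans hsum; rewrite esum_fset //.
  by rewrite fsbig_finite.
apply: (le_trans (leeD2l _ (lee_wpmul2l _ S4))); first by rewrite lee_fin.
rewrite -EFinM -EFinD lee_fin -/C1 -/C2 -/L' /A /B le_eqVlt; apply/orP; left; apply/eqP.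
ring.
Qed.

(** The noise is at most that of the largest model of the resolution, and the bias at
    most that of the scaling function alone. *)
Lemma crude_risk n : (0 < n)%N -> exists2 c : R, 0 <= c & forall s, L2 mu s ->
  (\int[P]_w (loss s n w)%:E <= (bias s (indices set0) + c)%:E)%E.
Proof.
move=> n0.
have nR : 0 < n%:R :> R by rewrite ltr0n.
pose K := `|Num.max (j0 n) 0|%N.
pose U := [set jk : nat * nat | (jk.1 < K)%N /\ (jk.2 < 2 ^ jk.1)%N].
have UW : U `<=` wavelet_indices by move=> jk [].
have finU : finite_set U.
  apply: (@sub_finite_set _ _ (`I_K `*` `I_(2 ^ K))); last exact: finite_setX.
  move=> [j k] [/= jK kj]; split => //=; apply: (leq_trans kj).
  by rewrite leq_exp2l // ltnW.
exists ((size (indices U))%:R / n%:R) => [|s hs]; first by rewrite divr_ge0.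
have fin0 : finite_set (set0 : set (nat * nat)) by exact: finite_set0.
have w0 : (set0 : set (nat * nat)) `<=` wavelet_indices by [].
have bias00 : 0 <= bias s (indices set0).
  by apply: (bias_ge0 eL2 eon) => //; [exact: uniq_indices|exact: indices_Psi].
have mX i : measurable_fun [set: T] (fun w => xi n w i ^+ 2).
  by apply: measurable_funX; exact: measurable_funM.
apply: (@le_trans _ _ (\int[P]_w ((bias s (indices set0))%:E +
    \sum_(i <- indices U) (xi n w i ^+ 2)%:E))%E).
  apply: ae_le_integral_measr.
  - by move=> w; rewrite lee_fin sqr_ge0.
  - by move=> w; rewrite sumEFin -EFinD lee_fin addr_ge0 // sumr_ge0 // => i _; rewrite sqr_ge0.
  - apply: emeasurable_funD; first exact: measurable_cst.
    by apply: emeasurable_sum => i; apply/measurable_EFinP.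
  - move: hWlin; apply: filterS => w lw.
    have [J [I hI mI] _] := selected_model eL2 eon theta_gt2 lambda_gt0 hmt n0 hs lw.
    have fI := finite_truncate theta_gt2 (j0 n) hI.
    have sI := @truncate_wavelet _ _ (j0 n) _ _ hI.
    rewrite /squared_loss mI (loss_model eL2 eon n hs lw fI sI) sumEFin -EFinD lee_fin.
    apply: lerD.
      apply: bias_sub; [exact: uniq_indices|exact: uniq_indices|].
      by move=> i; rewrite /indices fset_set0 /= inE => /eqP ->; rewrite mem_head.
    have subU : {subset indices (truncate (j0 n) I) <= indices U}.
      move=> [jk|]; last by rewrite !mem_head.
      rewrite !mem_indices // !inE => h; have := sI _ h; case: h => _.
      by rewrite /U /wavelet_indices /= /K => ? ?; split => //; lia.
    by apply: ler_sum_sub; rewrite ?uniq_indices // => i; exact: sqr_ge0.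
rewrite ge0_integralD //; last 2 first.
- by move=> w _; rewrite sumEFin lee_fin sumr_ge0 // => i _; rewrite sqr_ge0.
- by apply: emeasurable_sum => i; apply/measurable_EFinP.
rewrite integral_cst //= probability_setT mule1 [leRHS]EFinD leeD2lE //.
rewrite ge0_integral_sum //; last 2 first.
- by move=> i; apply/measurable_EFinP.
- by move=> i w _; rewrite lee_fin sqr_ge0.
have X2 i : i \in indices U -> (\int[P]_w (xi n w i ^+ 2)%:E = (n%:R^-1)%:E)%E.
  move=> /(indices_Psi finU UW) Di; case: hW => _ _ cW.
  have E1 : (\int[P]_w (W (e i) w ^+ 2)%:E = 1%:E)%E.
    have := cW _ _ (eL2 Di) (eL2 Di); rewrite eon // eqxx unlock => <-.
    by apply: eq_integral => w _; rewrite expr2.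
  under eq_integral do rewrite expr_div_n sqr_sqrtr ?ler0n // mulrC EFinM.
  rewrite ge0_integralZl_EFin ?invr_ge0 //.
  - by rewrite E1 mule1.
  - by move=> w _; rewrite lee_fin sqr_ge0.
  - by apply/measurable_EFinP; exact: measurable_funX.
by rewrite (eq_big_seq _ X2) sumEFin lee_fin big_const_seq count_predT iter_addr_0 -[leLHS]mulr_natl lexx.
Qed.

End UpperRisk.

(** * Besov and approximation balls in wavelet coordinates *)

Section Balls.
Context {R : realType} (phi psi : R -> R) (theta : R).
Local Notation mu := (@leb01 R).
Local Notation e := (Psi phi psi).
Hypothesis eL2 : forall i, Psi_indices i -> L2 mu (e i).
Hypothesis eon : forall i j, Psi_indices i -> Psi_indices j ->
  ip mu (e i) (e j) = (i == j)%:R.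
Hypothesis theta_gt2 : 2 < theta.
Local Notation b s := (fun i => ip mu s (e i)).
Local Notation D := (dimJ phi psi theta).
Local Notation bias := (squared_bias phi psi).

Definition block (J N : nat) : seq (option (nat * nat)) :=
  [seq Some (j, k) | j <- index_iota J N, k <- iota 0 (2 ^ j)].

Lemma mem_block J N j k :
  (Some (j, k) \in block J N) = ((J <= j < N) && (k < 2 ^ j))%N.
Proof.
apply/allpairsPdep/idP => [[j' [k' []]]|/andP[jJN k2]].
  by rewrite mem_index_iota mem_iota /= => h1 h2 [-> ->]; rewrite h1.
by exists j, k; rewrite mem_index_iota mem_iota.
Qed.

Lemma block_Psi J N i : i \in block J N -> Psi_indices i.
Proof.
case: i => [[j k]|]; first by rewrite mem_block => /andP[_ h]; right; exists (j, k).
by move=> _; left.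
Qed.

Lemma block_Some J N i : i \in block J N ->
  exists j k, i = Some (j, k) /\ (J <= j < N)%N.
Proof.
by case/allpairsPdep => j [k [+ _ ->]]; rewrite mem_index_iota => h; exists j, k.
Qed.

Lemma uniq_block J N : uniq (block J N).
Proof.
apply: allpairs_uniq_dep => [|j _|[j k] [j' k'] _ _ []]; rewrite ?iota_uniq //.
by move=> -> ->.
Qed.

Lemma sum_block s J N : \sum_(i <- block J N) b s i ^+ 2 =
  \sum_(J <= j < N) \sum_(k < 2 ^ j) coef phi psi s j k ^+ 2.
Proof.
rewrite big_allpairs_dep; apply: eq_bigr => j _.
by rewrite -/(index_iota 0 _) -[in LHS](subn0 (2 ^ j)%N) -/(index_iota 0 (2 ^ j)) big_mkord.
Qed.

Section Block.
Variables (s : R -> R) (I : set (nat * nat)) (J : nat).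
Hypothesis hs : L2 mu s.
Hypothesis finI : finite_set I.
Hypothesis wI : I `<=` wavelet_indices.
Hypothesis lowI : forall jk, I jk -> (jk.1 < J)%N.

Lemma uniq_indices_block N : uniq (indices I ++ block J N).
Proof.
rewrite cat_uniq uniq_indices uniq_block andbT /=; apply/hasPn => i /block_Some[j [k [-> /andP[Jj _]]]].
by rewrite /= mem_indices //; apply/negP => /set_mem/lowI /=; rewrite ltnNge Jj.
Qed.

(** The coefficients of these levels are all missed by the model. *)
Lemma block_le_bias N : \sum_(i <- block J N) b s i ^+ 2 <= bias s (indices I).
Proof.
rewrite lerBrDl -big_cat; apply: (bessel eL2 eon) => //; first exact: uniq_indices_block.
by move=> i; rewrite mem_cat => /orP[]; [exact: indices_Psi|exact: block_Psi].
Qed.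

(** A finite index set only reaches finitely many levels, which gives [N]. *)
Lemma bias_le_block I' : finite_set I' -> I' `<=` wavelet_indices ->
  (forall jk, I' jk -> I jk \/ (J <= jk.1)%N) ->
  exists N, bias s (indices I) <= bias s (indices I') + \sum_(i <- block J N) b s i ^+ 2.
Proof.
move=> finI' wI' hI'.
exists (\max_(jk <- fset_set I') jk.1).+1.
rewrite -lerBlDr {1}/squared_bias -addrA -opprD -big_cat.
apply: bias_sub; [exact: uniq_indices|exact: uniq_indices_block|].
move=> [[j k]|] h; last by rewrite mem_head.
rewrite mem_cat mem_indices //; move: h; rewrite mem_indices // => /set_mem h.
have [hI|Jj] := hI' _ h; first by rewrite mem_set.
rewrite mem_block (wI' _ h) /= andbT ltnS Jj /=; apply/orP; right.
by apply: (@leq_bigmax_seq _ _ predT (fun jk => jk.1) (j, k)) => //; rewrite in_fset_set // mem_set.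
Qed.

End Block.

Lemma besov_tail_le s J t : (forall N, \sum_(i <- block J N) b s i ^+ 2 <= t) ->
  (\sum_(J <= j <oo) (\sum_(k < 2 ^ j) coef phi psi s j k ^+ 2)%:E <= t%:E)%E.
Proof.
move=> h; apply: lime_le.
  apply: is_cvg_nneseries => n _ _; rewrite lee_fin.
  by apply: sumr_ge0 => k _; exact: sqr_ge0.
by apply: nearW => N; rewrite sumEFin lee_fin -sum_block.
Qed.

Lemma le_besov_tail s J t :
  (\sum_(J <= j <oo) (\sum_(k < 2 ^ j) coef phi psi s j k ^+ 2)%:E <= t%:E)%E ->
  forall N, \sum_(i <- block J N) b s i ^+ 2 <= t.
Proof.
move=> h N; rewrite -lee_fin; apply: le_trans h; rewrite sum_block -sumEFin.
apply: nneseries_lim_ge => n _ _; rewrite lee_fin.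
by apply: sumr_ge0 => k _; exact: sqr_ge0.
Qed.

Lemma besov_ballE s alpha rad : besov_ball phi psi alpha rad s ->
  forall J N, 2 `^ (2 * J%:R * alpha / (1 + 2 * alpha)) *
    \sum_(i <- block J N) b s i ^+ 2 <= rad.
Proof.
move=> [hs h] J N; have p0 : 0 < 2 `^ (2 * J%:R * alpha / (1 + 2 * alpha)) :> R.
  exact: powR_gt0.
rewrite -ler_pdivlMl //; move: N; apply: le_besov_tail.
have : ((2 `^ (2 * J%:R * alpha / (1 + 2 * alpha)))%:E *
  \sum_(J <= j <oo) (\sum_(k < 2 ^ j) coef phi psi s j k ^+ 2)%:E <= rad%:E)%E.
  by apply: le_trans h; apply: ereal_sup_ubound; exists J.
by rewrite EFinM lee_pdivlMl.
Qed.

(** The factor 2 leaves room for the infimum not to be attained. *)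
Lemma approx_ballE s alpha rad (M : R) : 0 < rad -> approx_ball phi psi theta alpha rad s ->
  (D 0)%:R <= M ->
  exists J I, [/\ index_sets theta J I, (D J)%:R <= M &
    bias s (indices I) <= (2 * rad * M `^ (- alpha)) ^+ 2].
Proof.
move=> rad0 [hs h] DM.
have M0 : 0 < M by apply: lt_le_trans DM; rewrite ltr0n dimJ_gt0.
have modelE J I : index_sets theta J I ->
    l2dim mu (model_of phi psi I) = D J.
  move=> hI; rewrite (l2dim_model eL2 eon) ?(dimJE eL2 eon theta_gt2 hI) //.
    exact: (card_index_sets theta_gt2 hI).1.
  exact: index_sets_wavelet hI.
set S := [set (nrm mu (oproj mu m s \- s))%:E | m in
  [set m | models phi psi theta m /\ (l2dim mu m)%:R <= M]].
have hM : ((M `^ alpha)%:E * ereal_inf S <= rad%:E)%E.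
  apply: le_trans h; apply: ereal_sup_ubound; exists M => //; split => //.
  have [I hI] := index_sets_neq0 theta_gt2 0.
  exists (model_of phi psi I); first by exists 0%N, I.
  by rewrite (modelE _ _ hI).
have Ma : 0 < M `^ alpha by exact: powR_gt0.
have : (ereal_inf S < (2 * rad * M `^ (- alpha))%:E)%E.
  move: hM; rewrite -lee_pdivlMl // => hM; apply: (le_lt_trans hM).
  rewrite -EFinM lte_fin powRN mulrC ltr_pM2r ?invr_gt0 //.
  by rewrite mulr_natl mulr2n ltrDl.
move=> /ereal_inf_lt[_ [m [[J [I [hI mE]]] mM] <-]]; rewrite lte_fin => hn.
exists J, I; split => //; first by rewrite -(modelE _ _ hI) -mE.
have fI := (card_index_sets theta_gt2 hI).1; have wI := index_sets_wavelet hI.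
have -> : bias s (indices I) = nrm mu (oproj mu m s \- s) ^+ 2.
  by rewrite mE model_of_indices // (nrm_oproj eL2 eon (uniq_indices I) (indices_Psi fI wI)).
have n0 : 0 <= nrm mu (oproj mu m s \- s) by exact/fine_ge0/Lnorm_ge0.
by apply: lerXn2r; rewrite ?nnegrE ?(ltW hn) // (le_trans n0 (ltW hn)).
Qed.

End Balls.

(** * Rates along the resolution levels *)

Lemma powR_pD {R : realType} (z a c : R) : 0 < z -> z `^ (a + c) = z `^ a * z `^ c.
Proof. by move=> z0; rewrite powRD // (gt_eqF z0) implybT. Qed.

Lemma powR_le {R : realType} (a c z : R) : 0 <= z -> 0 <= a -> a <= c -> a `^ z <= c `^ z.
Proof. by move=> z0 a0 ac; apply: ge0_ler_powR; rewrite ?nnegrE // (le_trans a0). Qed.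

Lemma powR_double {R : realType} (c z : R) : 0 <= c -> 0 <= z <= 1 -> (2 * c) `^ z <= 2 * c `^ z.
Proof.
move=> c0 /andP[z0 z1]; rewrite powRM //; apply: ler_wpM2r; first exact: powR_ge0.
by apply: (@le_trans _ _ (2 `^ 1)); [apply: ler_powR; rewrite // ler1n|rewrite powRr1].
Qed.

Lemma nat_lt_absz (J : nat) (z : int) : J%:Z < z -> (J < `|z|)%N.
Proof. lia. Qed.

Lemma le_absz_max (z : int) : z <= `|Num.max z 0|%N%:Z.
Proof. lia. Qed.

(** Used to choose a sample size n0 2^i that matches a given dimension or level. *)
Lemma first_crossing (p : nat -> bool) : ~~ p 0%N -> (exists i, p i) ->
  exists i, ~~ p i /\ p i.+1.
Proof.
move=> p0 ep; case: (ex_minnP ep) => -[|i] pi imin; first by rewrite pi in p0.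
by exists i; split => //; apply/negP => /imin; rewrite ltnn.
Qed.


Section Maxiset.
Context {R : realType} (phi psi : R -> R) (theta : R).
Local Notation mu := (@leb01 R).
Local Notation e := (Psi phi psi).
Hypothesis eL2 : forall i, Psi_indices i -> L2 mu (e i).
Hypothesis eon : forall i j, Psi_indices i -> Psi_indices j ->
  ip mu (e i) (e j) = (i == j)%:R.
Hypothesis theta_gt2 : 2 < theta.
Context (d : measure_display) (T : measurableType d)
  (P : probability T R) (W : (R -> R) -> {RV P >-> R}).
Hypothesis hW : white_noise W.
Local Notation V := (lspan (e @` Psi_indices)).
Hypothesis hWlin : {ae P, forall w, linear_on V (fun u => W u w)}.
Context (lambda : nat -> R) (j0 : nat -> int)
  (mt : nat -> ((R -> R) -> R) -> set (R -> R)).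
Hypothesis lambda_gt0 : forall n, (0 < n)%N -> 0 < lambda n.
Hypothesis hmt : selection_rule phi psi theta lambda j0 mt.

Local Notation b s := (fun i => ip mu s (e i)).
Local Notation xi n w := (fun i => W (e i) w / Num.sqrt n%:R).
Local Notation D := (dimJ phi psi theta).



Local Notation bias := (squared_bias phi psi).
Local Notation loss := (squared_loss W mt).
Context (alpha : R).
Hypothesis alpha_gt0 : 0 < alpha.
Local Notation q := (2 * alpha / (1 + 2 * alpha)).
Local Notation x n := (lambda n / n%:R).

Lemma expo_gt0 : 0 < q.
Proof. by have a0 := alpha_gt0; apply: divr_gt0; lra. Qed.
Lemma expo_lt1 : q < 1.
Proof. by have a0 := alpha_gt0; rewrite ltr_pdivrMr; lra. Qed.

Lemma x_gt0 n : (0 < n)%N -> 0 < x n.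
Proof. by move=> n0; rewrite divr_gt0 ?ltr0n ?lambda_gt0. Qed.

Lemma rate_sqr n : (0 < n)%N -> rate lambda alpha n ^+ 2 = x n `^ q.
Proof.
move=> n0; rewrite /rate -powR_mulrn ?powR_ge0 // -powRrM; congr (_ `^ _).
have a0 := alpha_gt0; field; rewrite gt_eqF //; lra.
Qed.

Hypothesis j0P : forall n, (0 < n)%N -> 2 ^ j0 n <= n%:R * (lambda n)^-1 < 2 ^ (j0 n + 1).

Lemma level_le n : (0 < n)%N -> 2 ^ j0 n <= (x n)^-1.
Proof. by move=> n0; have /andP[+ _] := j0P n0; rewrite invf_div. Qed.

Lemma level_gt n : (0 < n)%N -> (x n)^-1 < 2 ^ (j0 n + 1).
Proof. by move=> n0; have /andP[_] := j0P n0; rewrite invf_div. Qed.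

Lemma exp2_level_le n (J : nat) : (0 < n)%N -> (j0 n <= J%:Z)%R -> ((2 ^+ J)^-1 : R) <= 2 * x n.
Proof.
move=> n0 hJ; have X0 := x_gt0 n0.
have X2 : 0 < 2 * x n by exact: mulr_gt0.
rewrite -[leRHS]invrK lef_pV2 ?posrE ?exprn_gt0 ?invr_gt0 //.
rewrite invfM ler_pdivrMl //; apply: (le_trans (ltW (level_gt n0))).
rewrite expfzDr // expr1z mulrC ler_pM2l //.
rewrite -[2 ^+ J]/((2 : R) ^ J%:Z); by apply: ler_weXz2l; rewrite // ler1n.
Qed.

Lemma le_exp2_level n (J : nat) : (0 < n)%N -> (J%:Z < j0 n)%R -> x n <= ((2 ^+ J.+1)^-1 : R).
Proof.
move=> n0 hJ; have X0 := x_gt0 n0.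
rewrite -[leLHS]invrK lef_pV2 ?posrE ?invr_gt0 ?exprn_gt0 //.
apply: le_trans (level_le n0).
rewrite -[2 ^+ J.+1]/((2 : R) ^ J.+1%:Z); apply: ler_weXz2l; first by rewrite ler1n.
lia.
Qed.

Lemma maxiset_ballE rad s n : 0 < rad ->
  maxiset_ball W (fun n y => shat y (mt n y)) (rate lambda alpha) rad s -> (0 < n)%N ->
  (\int[P]_w (loss s n w)%:E <= (rad ^+ 2 * x n `^ q)%:E)%E.
Proof.
move=> rad0 [hs h] n0.
have X0 : 0 < x n `^ q by apply/powR_gt0/x_gt0.
have := le_trans (ereal_sup_ubound (ex_intro2 _ _ n n0 erefl)) h.
by rewrite rate_sqr // expectation_loss lee_pdivrMl // muleC -EFinM.
Qed.

Lemma maxiset_ballI rad s : L2 mu s ->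
  (forall n, (0 < n)%N -> (\int[P]_w (loss s n w)%:E <= (rad ^+ 2 * x n `^ q)%:E)%E) ->
  maxiset_ball W (fun n y => shat y (mt n y)) (rate lambda alpha) rad s.
Proof.
move=> hs h; split => //; apply: ge_ereal_sup => _ [n /= n0 <-].
have X0 : 0 < x n `^ q by apply/powR_gt0/x_gt0.
by rewrite rate_sqr // expectation_loss lee_pdivrMl // muleC -EFinM; exact: h.
Qed.

(** * From the maxiset to the balls *)

Section MaxisetToBalls.
Context (n0 : nat) (delta : R).
Hypothesis n0_gt0 : (0 < n0)%N.
Hypothesis delta_gt0 : 0 < delta.
Hypothesis delta_lt1 : delta < 1.
Hypothesis lambda_double : forall n, (n0 <= n)%N ->
  lambda (2 * n)%N <= 2 * (1 - delta) * lambda n.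
Hypothesis lambda_mono : forall n m, (0 < n)%N -> (n <= m)%N -> lambda n <= lambda m.
Hypothesis x_small : forall eps : R, 0 < eps -> exists N, forall n, (N <= n)%N -> x n < eps.
Hypothesis lambda1 : 1 / 2 < lambda 1%N.
Hypothesis j0_mono : forall n m, (0 < n)%N -> (n <= m)%N -> j0 n <= j0 m.

Definition dyadic i : nat := (2 ^ i * n0)%N.

Lemma dyadic_gt0 i : (0 < dyadic i)%N.
Proof. by rewrite muln_gt0 expn_gt0. Qed.

Lemma dyadicS i : dyadic i.+1 = (2 * dyadic i)%N.
Proof. by rewrite /dyadic expnS mulnA. Qed.

Lemma n0_le_dyadic i : (n0 <= dyadic i)%N.
Proof. by rewrite leq_pmull // expn_gt0. Qed.

Lemma dyadic_ge i : (i <= dyadic i)%N.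
Proof. by apply: (leq_trans (ltnW (ltn_expl i (ltnSn 1)))); rewrite leq_pmulr. Qed.

Local Notation X i := (x (dyadic i)).

Lemma X_gt0 i : 0 < X i. Proof. exact/x_gt0/dyadic_gt0. Qed.

Lemma X_contract i : X i.+1 <= (1 - delta) * X i.
Proof.
have N0 : 0 < (dyadic i)%:R :> R by rewrite ltr0n dyadic_gt0.
rewrite dyadicS natrM ler_pdivrMr ?mulr_gt0 //.
have -> : (1 - delta) * X i * (2 * (dyadic i)%:R) = 2 * (1 - delta) * lambda (dyadic i).
  by field; rewrite gt_eqF.
exact/lambda_double/n0_le_dyadic.
Qed.

Lemma X_half i : X i <= 2 * X i.+1.
Proof.
have N0 : 0 < (dyadic i)%:R :> R by rewrite ltr0n dyadic_gt0.
rewrite dyadicS natrM.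
have -> : 2 * (lambda (2 * dyadic i)%N / (2 * (dyadic i)%:R)) =
   lambda (2 * dyadic i)%N / (dyadic i)%:R by field; rewrite gt_eqF.
rewrite ler_pM2r ?invr_gt0 //; apply: lambda_mono; first exact: dyadic_gt0.
by rewrite leq_pmull.
Qed.

Lemma X_small (eps : R) : 0 < eps -> exists i, X i < eps.
Proof. by move=> /x_small[N hN]; exists N; apply: hN; exact: dyadic_ge. Qed.

(** Since 2^(j0 1) <= 1 / lambda 1 < 2. *)
Lemma level1_le0 : j0 1%N <= 0.
Proof.
rewrite leNgt; apply/negP => h.
have /andP[+ _] := j0P (ltnSn 0); rewrite mul1r leNgt => /negP; apply.
have l1 := lambda_gt0 (ltnSn 0).
apply: (@lt_le_trans _ _ 2).
  by rewrite -[ltRHS]invrK ltf_pV2 ?posrE ?invr_gt0 //; have := lambda1; lra.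
have -> : 2 = 2 ^ 1 :> R by rewrite expr1z.
by apply: ler_weXz2l; rewrite ?ler1n //; lia.
Qed.

(* x at [dyadic i.+1] is at most 1 - delta times x at [dyadic i], and the penalty over
   the squared rate scales like x^(1 - q). *)
Local Notation tau := ((1 - delta) `^ (1 - q)).

Lemma tau_lt1 : tau < 1.
Proof.
have d0 := delta_gt0; have d1 := delta_lt1; have q1 := expo_lt1.
apply: (@lt_le_trans _ _ (1 `^ (1 - q))); last by rewrite powR1.
by apply: gt0_ltr_powR; rewrite ?nnegrE; lra.
Qed.

Section OneSignal.
Variables (rad : R) (s : R -> R).
Hypothesis rad_gt0 : 0 < rad.
Hypothesis hs : L2 mu s.
Hypothesis hrisk : forall n, (0 < n)%N ->
  (\int[P]_w (loss s n w)%:E <= (rad ^+ 2 * x n `^ q)%:E)%E.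

Let B0 : R := 2 * (rad ^+ 2 * x 1%N `^ q).
Let K1 : R := 2 * rad ^+ 2 + B0 / X 0 `^ q.
Let K2 : R := X 0 * (D 0)%:R / X 0 `^ q + (4 * K1 + 4 * rad ^+ 2) / (1 - tau).

Let rad2 : 0 < rad ^+ 2. Proof. exact: exprn_gt0. Qed.
Let XQ i : 0 < X i `^ q. Proof. exact/powR_gt0/X_gt0. Qed.

Let B0_ge0 : 0 <= B0.
Proof. by rewrite mulr_ge0 // mulr_ge0 ?powR_ge0 // ltW. Qed.

(** At n = 1 the only model is spanned by the scaling function. *)
Lemma bias0_le : bias s (indices set0) <= B0.
Proof.
have v0 : 0 < rad ^+ 2 * x 1%N `^ q by rewrite mulr_gt0 ?powR_gt0 ?x_gt0.
have [J [I [hI hb _]]] := risk_selects eL2 eon theta_gt2 hWlin lambda_gt0 hmt (ltnSn 0) hs v0 (hrisk (ltnSn 0)).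
move: hb; rewrite (_ : truncate _ _ = set0) //; apply/seteqP; split => // -[j k] [_ /=].
by rewrite ltNge (le_trans level1_le0).
Qed.

Let K1_gt0 : 0 < K1.
Proof.
by rewrite ltr_wpDr ?mulr_gt0 // divr_ge0 ?mulr_ge0 ?powR_ge0 // ltW.
Qed.

Let excess_ge0 : 0 <= (4 * K1 + 4 * rad ^+ 2) / (1 - tau).
Proof.
apply: divr_ge0; last by rewrite subr_ge0; exact/ltW/tau_lt1.
by apply: addr_ge0; apply: mulr_ge0 => //; exact: ltW.
Qed.

Let K2_gt0 : 0 < K2.
Proof.
apply: ltr_pwDl; first by rewrite divr_gt0 // mulr_gt0 ?X_gt0 // ltr0n dimJ_gt0.
exact: excess_ge0.
Qed.

Lemma bias_truncate_le (j : int) J I : index_sets theta J I ->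
  bias s (indices (truncate j I)) <= bias s (indices set0).
Proof.
move=> hI; apply: bias_sub; [exact: uniq_indices|exact: uniq_indices|].
by move=> i; rewrite /indices fset_set0 /= inE => /eqP ->; rewrite mem_head.
Qed.

(** Induction on [i], comparing the model selected at [dyadic i.+1] with the model
    found at [dyadic i]. The constant [K2] dominates the initial penalty and is such
    that tau K2 + 4 K1 + 4 rad^2 <= K2, where [tau] is the contraction factor. *)
Lemma selected_along_dyadic i : exists J I, [/\ index_sets theta J I,
  bias s (indices (truncate (j0 (dyadic i)) I)) <= K1 * X i `^ q
  & X i * (D J)%:R <= K2 * X i `^ q].
Proof.
have t1 := tau_lt1.
elim: i => [|i [J [I [hI hb hp]]]].
  have [I hI] := index_sets_neq0 theta_gt2 0; exists 0%N, I; split => //.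
    apply: (le_trans (bias_truncate_le _ hI)); apply: (le_trans bias0_le).
    by rewrite mulrDl divfK ?gt_eqF // lerDr mulr_ge0 ?mulr_ge0 ?powR_ge0 // ltW.
  by rewrite mulrDl divfK ?gt_eqF // lerDl mulr_ge0 ?powR_ge0.
have v0 : 0 < rad ^+ 2 * X i.+1 `^ q by rewrite mulr_gt0.
have [J' [I' [hI' hb' hp']]] := risk_selects eL2 eon theta_gt2 hWlin lambda_gt0 hmt
  (dyadic_gt0 i.+1) hs v0 (hrisk (dyadic_gt0 i.+1)).
exists J', I'; split => //.
  apply: (le_trans hb'); rewrite mulrA ler_pM2r // lerDl.
  by apply: divr_ge0; [exact: B0_ge0|exact: ltW].
apply: (le_trans (hp' _ _ hI)).
have q0 := expo_gt0; have q1 := expo_lt1.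
have x0 := X_gt0 i; have x1 := X_gt0 i.+1.
have hb2 : bias s (indices (truncate (j0 (dyadic i.+1)) I)) <= 2 * K1 * X i.+1 `^ q.
  apply: (@le_trans _ _ (bias s (indices (truncate (j0 (dyadic i)) I)))).
    apply: bias_sub; [exact: uniq_indices|exact: uniq_indices|].
    move=> [jk|]; last by rewrite !mem_head.
    rewrite !mem_indices; [|exact: finite_truncate hI|exact: finite_truncate hI].
    move=> /set_mem[h1 h2]; apply/mem_set; split => //; apply: (lt_le_trans h2).
    by apply: j0_mono; [exact: dyadic_gt0|rewrite dyadicS leq_pmull].
  apply: (le_trans hb).
  have -> : 2 * K1 * X i.+1 `^ q = K1 * (2 * X i.+1 `^ q) by ring.
  rewrite ler_pM2l //; apply: le_trans (powR_double (ltW x1) _); last by rewrite (ltW q0) (ltW q1).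
  by apply: powR_le; rewrite ?(ltW q0) ?(ltW x0) ?X_half.
have hp2 : X i.+1 * (D J)%:R <= tau * K2 * X i.+1 `^ q.
  have hD : (D J)%:R <= K2 * X i `^ (q - 1).
    rewrite powR_pD // powRN powRr1 ?(ltW x0) // mulrA ler_pdivlMr // mulrC; exact: hp.
  apply: (le_trans (ler_wpM2l (ltW x1) hD)).
  have E : X i.+1 = X i.+1 `^ q * X i.+1 `^ (1 - q).
    by rewrite -powR_pD // addrC subrK powRr1 // ltW.
  rewrite {1}E.
  have -> : X i.+1 `^ q * X i.+1 `^ (1 - q) * (K2 * X i `^ (q - 1)) =
     K2 * X i.+1 `^ q * (X i.+1 `^ (1 - q) * X i `^ (q - 1)) by ring.
  have -> : tau * K2 * X i.+1 `^ q = K2 * X i.+1 `^ q * tau by ring.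
  rewrite ler_pM2l ?mulr_gt0 //.
  rewrite -[q - 1]opprB powRN ler_pdivrMr ?powR_gt0 // -powRM ?subr_ge0 ?(ltW x0) //; last first.
    exact: ltW delta_lt1.
  by apply: powR_le; rewrite ?subr_ge0 ?(ltW q1) ?(ltW x1) // X_contract.
have : K2 * X i.+1 `^ q >= tau * K2 * X i.+1 `^ q + (4 * K1 + 4 * rad ^+ 2) * X i.+1 `^ q.
  rewrite -mulrDl ler_pM2r //.
  have : (4 * K1 + 4 * rad ^+ 2) <= K2 * (1 - tau).
    rewrite [leRHS]mulrDl divfK ?gt_eqF ?subr_gt0 // lerDr; apply: mulr_ge0.
      by rewrite divr_ge0 ?powR_ge0 // mulr_ge0 // ltW // X_gt0.
    by rewrite subr_ge0 ltW.
  lra.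
lra.
Qed.

(** The models found along [dyadic] have dimension at most [a i]. If [M] lies between
    [a i] and [a i.+1], which is at most twice as large, the i-th one will do. Below
    [a 0] the given model [m0] suffices, as the total bias is bounded. *)
Lemma approx_bound (M : R) m0 : 0 < M -> models phi psi theta m0 ->
  (l2dim mu m0)%:R <= M ->
  exists2 m, models phi psi theta m /\ (l2dim mu m)%:R <= M &
    M `^ alpha * nrm mu (oproj mu m s \- s) <=
    (K2 * X 0 `^ (q - 1)) `^ alpha * Num.sqrt B0 + (2 * K2) `^ alpha * Num.sqrt K1.
Proof.
move=> M0 [J0 [I0 [hI0 ->]]] hM0.
have a0 := alpha_gt0; have q0 := expo_gt0; have q1 := expo_lt1.
have nrmE' J I : index_sets theta J I ->
    nrm mu (oproj mu (model_of phi psi I) s \- s) = Num.sqrt (bias s (indices I)).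
  move=> hI; have fI := (card_index_sets theta_gt2 hI).1; have wI := index_sets_wavelet hI.
  rewrite model_of_indices // /squared_bias -(nrm_oproj eL2 eon (uniq_indices I) (indices_Psi fI wI) hs).
  by rewrite sqrtr_sqr ger0_norm //; exact/fine_ge0/Lnorm_ge0.
pose a i := K2 * X i `^ (q - 1).
have [Ma|aM] := ltP M (a 0%N).
  exists (model_of phi psi I0); first by split => //; exists J0, I0.
  rewrite (nrmE' _ _ hI0) -[leLHS]addr0; apply: lerD; last by rewrite mulr_ge0 ?powR_ge0.
  apply: ler_pM; rewrite ?powR_ge0 ?sqrtr_ge0 //.
    by apply: powR_le; rewrite ?(ltW a0) ?(ltW M0) ?(ltW Ma).
  rewrite ler_wsqrtr //; apply: le_trans bias0_le.
  apply: bias_sub; [exact: uniq_indices|exact: uniq_indices|].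
  by move=> i; rewrite /indices fset_set0 /= inE => /eqP ->; rewrite mem_head.
have [i [+ Mi]] : exists i, ~~ (M < a i) /\ M < a i.+1.
  apply: first_crossing; first by rewrite -leNgt.
  have [i hi] := X_small (powR_gt0 (q - 1)^-1 (divr_gt0 M0 K2_gt0)).
  exists i; rewrite /a mulrC -ltr_pdivrMr //.
  have e0 : 0 < (M / K2) by rewrite divr_gt0.
  have -> : M / K2 = ((M / K2) `^ (q - 1)^-1) `^ (q - 1).
    by rewrite -powRrM mulVf ?powRr1 ?(ltW e0) // subr_eq0 lt_eqF.
  rewrite -[q - 1]opprB !powRN ltf_pV2 ?posrE ?powR_gt0 ?X_gt0 //.
  by apply: gt0_ltr_powR; rewrite ?nnegrE ?subr_gt0 ?powR_ge0 ?(ltW (X_gt0 i)) ?opprB.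
rewrite -leNgt => aiM.
have [J [I [hI hb hp]]] := selected_along_dyadic i.
have x0 := X_gt0 i; have x1 := X_gt0 i.+1.
have hD : (D J)%:R <= a i.
  rewrite /a powR_pD // powRN powRr1 ?(ltW x0) // mulrA ler_pdivlMr // mulrC; exact: hp.
exists (model_of phi psi I).
  split; first by exists J, I.
  rewrite (l2dim_model eL2 eon (card_index_sets theta_gt2 hI).1 (index_sets_wavelet hI)).
  by rewrite -(dimJE eL2 eon theta_gt2 hI); exact: le_trans hD aiM.
rewrite (nrmE' _ _ hI) -[leLHS]add0r; apply: lerD; first by rewrite mulr_ge0 ?powR_ge0.
have hM : M <= 2 * K2 * X i `^ (q - 1).
  apply: (le_trans (ltW Mi)); rewrite /a.
  have -> : 2 * K2 * X i `^ (q - 1) = K2 * (2 * X i `^ (q - 1)) by ring.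
  rewrite ler_pM2l // -[q - 1]opprB !powRN.
  rewrite -[leRHS]invrK lef_pV2 ?posrE ?invr_gt0 ?mulr_gt0 ?invr_gt0 ?powR_gt0 //.
  rewrite invfM invrK ler_pdivrMl //.
  apply: le_trans (powR_double (ltW x1) _); last by rewrite subr_ge0 (ltW q1) gerBl ltW.
  by apply: powR_le; rewrite ?subr_ge0 ?(ltW q1) ?(ltW x0) // X_half.
have hbI : bias s (indices I) <= K1 * X i `^ q.
  apply: le_trans hb; apply: bias_sub; [exact: uniq_indices|exact: uniq_indices|].
  move=> [jk|]; last by rewrite !mem_head.
  rewrite !mem_indices; [|exact: (card_index_sets theta_gt2 hI).1|exact: finite_truncate hI].
  by move=> /set_mem[h1 h2]; apply/mem_set.
apply: (@le_trans _ _ ((2 * K2 * X i `^ (q - 1)) `^ alpha * Num.sqrt (K1 * X i `^ q))).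
  apply: ler_pM; rewrite ?powR_ge0 ?sqrtr_ge0 ?ler_wsqrtr //.
  by apply: powR_le; rewrite ?(ltW a0) ?(ltW M0).
rewrite powRM ?mulr_ge0 ?powR_ge0 ?(ltW K2_gt0) // sqrtrM ?(ltW K1_gt0) //.
have -> : Num.sqrt (X i `^ q) = X i `^ (q / 2).
  have -> : X i `^ q = (X i `^ (q / 2)) ^+ 2.
    by rewrite -powR_mulrn ?powR_ge0 // -powRrM divfK.
  by rewrite sqrtr_sqr ger0_norm // powR_ge0.
rewrite -powRrM.
have -> : (2 * K2) `^ alpha * X i `^ ((q - 1) * alpha) * (Num.sqrt K1 * X i `^ (q / 2)) =
  (2 * K2) `^ alpha * Num.sqrt K1 * (X i `^ ((q - 1) * alpha) * X i `^ (q / 2)) by ring.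
rewrite -powR_pD // (_ : _ + _ = 0) ?powRr0 ?mulr1 //.
by field; rewrite gt_eqF //; lra.
Qed.

(** For a level [J] between the maximal resolutions at [dyadic i] and [dyadic i.+1],
    the model found at [dyadic i] misses all coefficients beyond [J], and x at
    [dyadic i] is at most 2^-J. *)
Lemma besov_bound J N : 2 `^ (2 * J%:R * alpha / (1 + 2 * alpha)) *
  \sum_(i <- block J N) b s i ^+ 2 <=
  2 `^ (`|j0 (dyadic 0)|%:R * q) * B0 + K1.
Proof.
have a0 := alpha_gt0; have q0 := expo_gt0; have q1 := expo_lt1.
have -> : 2 * J%:R * alpha / (1 + 2 * alpha) = J%:R * q by ring.
have fin0 : finite_set (set0 : set (nat * nat)) by exact: finite_set0.
have S0 : 0 <= \sum_(i <- block J N) b s i ^+ 2 by apply: sumr_ge0 => i _; exact: sqr_ge0.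
have [Jlt|Jge] := ltP J%:Z (j0 (dyadic 0)).
  rewrite -[leLHS]addr0; apply: lerD; last exact: ltW.
  apply: ler_pM; rewrite ?powR_ge0 //.
    apply: ler_powR; first by rewrite ler1n.
    by rewrite ler_wpM2r ?(ltW q0) // ler_nat ltnW // nat_lt_absz.
  apply: le_trans bias0_le; exact: (block_le_bias eL2 eon).
have [i [+ hi]] : exists i, ~~ (J%:Z < j0 (dyadic i)) /\ J%:Z < j0 (dyadic i.+1).
  apply: first_crossing; first by rewrite -leNgt.
  have e0 : 0 < ((2 ^+ J.+1)^-1 : R) by rewrite invr_gt0 exprn_gt0.
  have [i hi] := X_small e0; exists i; rewrite ltNge; apply/negP => h.
  have := level_gt (dyadic_gt0 i); rewrite ltNge => /negP; apply.
  have x0 := X_gt0 i.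
  apply: (@le_trans _ _ (2 ^ J.+1%:Z)); first by apply: ler_weXz2l; rewrite ?ler1n // intS addrC lerD2l.
  by rewrite -[leLHS]invrK lef_pV2 ?posrE ?invr_gt0 ?exprn_gt0 // ltW.
rewrite -leNgt => iJ.
have [J' [I [hI hb _]]] := selected_along_dyadic i.
rewrite -[leLHS]add0r; apply: lerD; first by rewrite mulr_ge0 ?powR_ge0.
have x0 := X_gt0 i; have x1 := X_gt0 i.+1.
have hblk : \sum_(i <- block J N) b s i ^+ 2 <= K1 * X i `^ q.
  apply: le_trans hb; apply: (block_le_bias eL2 eon) => //.
  - exact: finite_truncate hI.
  - exact: truncate_wavelet hI.
  - by move=> jk [_ h]; have := lt_le_trans h iJ.
have hX : X i <= (2 ^+ J)^-1.
  apply: (le_trans (X_half i)).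
  have -> : 2 ^- J = 2 * 2 ^- J.+1 :> R.
    by rewrite exprS invfM mulrA divff ?mul1r.
  by rewrite ler_pM2l // le_exp2_level // dyadic_gt0.
apply: (@le_trans _ _ (2 `^ (J%:R * q) * (K1 * (2 ^+ J)^-1 `^ q))).
  apply: ler_wpM2l; first exact: powR_ge0.
  apply: (le_trans hblk); rewrite ler_pM2l //.
  by apply: powR_le; rewrite ?(ltW q0) ?(ltW x0).
rewrite mulrCA powRrM powR_mulrn // -powRM ?exprn_ge0 ?invr_ge0 ?exprn_ge0 //.
by rewrite divff ?powR1 ?mulr1 // expf_neq0.
Qed.

End OneSignal.

Lemma maxiset_sub_balls rad : 0 < rad -> exists2 r', 0 < r' &
  maxiset_ball W (fun n y => shat y (mt n y)) (rate lambda alpha) rad `<=`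
  besov_ball phi psi alpha r' `&` approx_ball phi psi theta alpha r'.
Proof.
move=> rad0.
have [Ca hCa] : exists C, forall s, L2 mu s -> (forall n, (0 < n)%N ->
    (\int[P]_w (loss s n w)%:E <= (rad ^+ 2 * x n `^ q)%:E)%E) ->
    forall M m0, 0 < M -> models phi psi theta m0 -> (l2dim mu m0)%:R <= M ->
    exists2 m, models phi psi theta m /\ (l2dim mu m)%:R <= M &
    M `^ alpha * nrm mu (oproj mu m s \- s) <= C.
  eexists => s hs hr M m0 M0 hm hM; exact: (approx_bound rad0 hs hr M0 hm hM).
have [Cb hCb] : exists C, forall s, L2 mu s -> (forall n, (0 < n)%N ->
    (\int[P]_w (loss s n w)%:E <= (rad ^+ 2 * x n `^ q)%:E)%E) ->
    forall J N, 2 `^ (2 * J%:R * alpha / (1 + 2 * alpha)) *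
      \sum_(i <- block J N) b s i ^+ 2 <= C.
  eexists => s hs hr J N; exact: (besov_bound rad0 hs hr).
exists (`|Ca| + `|Cb| + 1); first by rewrite ltr_wpDl ?addr_ge0.
have Ca1 : Ca <= `|Ca| + `|Cb| + 1.
  by rewrite (le_trans (ler_norm _)) // -addrA lerDl addr_ge0.
have Cb1 : Cb <= `|Ca| + `|Cb| + 1.
  by rewrite (le_trans (ler_norm _)) // addrAC lerDr addr_ge0.
move=> s hball; have hs := hball.1.
have hr n (n1 : (0 < n)%N) := maxiset_ballE rad0 hball n1.
split; split => //; apply: ge_ereal_sup.
  move=> _ [J _ <-]; rewrite -lee_pdivlMl ?powR_gt0 // -EFinM.
  apply: besov_tail_le => N; rewrite ler_pdivlMl ?powR_gt0 //.
  exact: le_trans (hCb _ hs hr J N) Cb1.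
move=> _ [M [M0 [m0 hm0 hM0]] <-].
have [m hm hC] := hCa _ hs hr _ _ M0 hm0 hM0.
apply: (@le_trans _ _ ((M `^ alpha)%:E * (nrm mu (oproj mu m s \- s))%:E)%E).
  apply: lee_wpmul2l; first by rewrite lee_fin powR_ge0.
  by apply: ereal_inf_lbound; exists m.
by rewrite -EFinM lee_fin; exact: le_trans hC Ca1.
Qed.

End MaxisetToBalls.

(** * From the balls to the maxiset *)

Section BallsToMaxiset.
Context (n0 : nat) (kappa Xmax : R).
Hypothesis n0_gt0 : (0 < n0)%N.
Hypothesis lambda_mono : forall n m, (0 < n)%N -> (n <= m)%N -> lambda n <= lambda m.
Hypothesis lambda_n0 : 8 <= lambda n0.
Hypothesis kappa_gt1 : 1 < kappa.
Hypothesis entropy : forall n, (0 < n)%N ->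
  (\esum_(m in models_upto phi psi theta (j0 n))
     (expR (- ((Num.sqrt (kappa^-1 * lambda n) - 1) ^+ 2 * (l2dim mu m)%:R / 2)))%:E <= 1)%E.
Hypothesis x_bounded : forall n, (0 < n)%N -> x n <= Xmax.

Let kappa' := Num.min kappa 2.

Lemma kappa'_bounds : 1 < kappa' <= 2.
Proof. by rewrite lt_min kappa_gt1 ge_min lexx orbT /= ltr1n. Qed.

Lemma lambda_ge8 n : (n0 <= n)%N -> 8 <= lambda n.
Proof. by move=> h; apply: (le_trans lambda_n0); exact: lambda_mono. Qed.

Lemma sqrt_lambda_ge2 n : (n0 <= n)%N -> 2 <= Num.sqrt (kappa'^-1 * lambda n).
Proof.
move=> h; have l8 := lambda_ge8 h; have /andP[k1 k2] := kappa'_bounds.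
have k0 : 0 < kappa' by lra.
have -> : 2 = Num.sqrt (2 ^+ 2) :> R by rewrite sqrtr_sqr ger0_norm.
by rewrite ler_wsqrtr // ler_pdivlMl //; lra.
Qed.

(** Decreasing [kappa] to at most 2 increases the exponents as soon as
    lambda n >= 8, so the entropy bound persists; this ensures that the argument of
    the chi-square bound is at least 2. *)
Lemma entropy_kappa' n : (n0 <= n)%N ->
  (\esum_(m in models_upto phi psi theta (j0 n))
     (expR (- ((Num.sqrt (kappa'^-1 * lambda n) - 1) ^+ 2 * (l2dim mu m)%:R / 2)))%:E <= 1)%E.
Proof.
move=> h; have n1 : (0 < n)%N by exact: leq_trans h.
apply: le_trans (entropy n1); apply: le_esum => m _.
rewrite lee_fin ler_expR lerN2 ler_pM2r ?invr_gt0 //; apply: ler_wpM2r => //.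
have l2 := sqrt_lambda_ge2 h; move: l2; rewrite /kappa' /Num.min.
case: ifPn => // k2; rewrite -leNgt in k2.
set l := Num.sqrt (2^-1 * _) => l2; set l' := Num.sqrt _.
have k0 : 0 < kappa by lra.
have ll : l' <= l.
  by rewrite ler_wsqrtr // ler_pM2r ?lambda_gt0 // lef_pV2 ?posrE.
have l0 : 0 <= l' by exact: sqrtr_ge0.
have [l1|l1] := leP 1 l'; first by rewrite lerXn2r ?nnegrE ?subr_ge0 ?lerB //; lra.
nra.
Qed.

(** Truncation removes the levels beyond [j], whose weight is a Besov tail. *)
Lemma bias_truncate_ball rad s (M : R) (j : int) : 0 < rad ->
  besov_ball phi psi alpha rad s -> approx_ball phi psi theta alpha rad s ->
  (D 0)%:R <= M ->
  exists J I, [/\ index_sets theta J I, (D J)%:R <= M &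
    bias s (indices (truncate j I)) <=
      (2 * rad * M `^ (- alpha)) ^+ 2 + rad * (2 ^- `|Num.max j 0|) `^ q].
Proof.
move=> rad0 hb ha DM; have hs := hb.1; set J0 := `|_|%N.
have [J [I [hI DJ hbias]]] := approx_ballE eL2 eon theta_gt2 rad0 ha DM.
exists J, I; split => //.
have low jk : truncate j I jk -> (jk.1 < J0)%N.
  by move=> [_]; rewrite /J0; move: (jk.1) => i; lia.
have high jk : I jk -> truncate j I jk \/ (J0 <= jk.1)%N.
  move=> h; have [lt|ge] := ltP jk.1%:Z j; first by left.
  by right; move: ge; rewrite /J0; move: (jk.1) => i; lia.
have [N hN] := bias_le_block phi psi s (finite_truncate theta_gt2 j hI)
  low (card_index_sets theta_gt2 hI).1 (index_sets_wavelet hI) high.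
apply: (le_trans hN); apply: lerD hbias _.
have := besov_ballE hb J0 N.
have -> : 2 * J0%:R * alpha / (1 + 2 * alpha) = J0%:R * q by ring.
rewrite mulrC -ler_pdivlMr ?powR_gt0 // => h; apply: (le_trans h).
rewrite powRrM powR_mulrn // -powRN ler_pM2l //.
rewrite powRN -powR_inv1 ?powR_ge0 // -powRrM mulrN1.
by rewrite -[2 ^- J0]powR_inv1 ?exprn_ge0 // -powRrM mulN1r.
Qed.

(** A sum over n < n0 of constants that do not depend on the signal. *)
Lemma risk_small_n rad : 0 < rad -> exists2 r, 0 <= r & forall n s, (0 < n)%N -> (n < n0)%N ->
  besov_ball phi psi alpha rad s -> approx_ball phi psi theta alpha rad s ->
  (\int[P]_w (loss s n w)%:E <= (r * x n `^ q)%:E)%E.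
Proof.
move=> rad0.
have /choice[c hc] : forall n, exists c, 0 <= c /\ ((0 < n)%N -> forall s, L2 mu s ->
   (\int[P]_w (loss s n w)%:E <= (bias s (indices set0) + c)%:E)%E).
  move=> n; have [n1|n1] := ltnP 0 n; last by exists 0.
  have [c c0 hc] := crude_risk eL2 eon theta_gt2 hW hWlin lambda_gt0 hmt n1.
  by exists c; split.
pose B := (2 * rad * (D 0)%:R `^ (- alpha)) ^+ 2 + rad.
have B0 : 0 <= B by rewrite addr_ge0 ?sqr_ge0 // ltW.
have XQ n : (0 < n)%N -> 0 < x n `^ q by move=> n1; exact/powR_gt0/x_gt0.
pose t n := (B + c n) / x n `^ q.
have t0 n : 0 <= t n by rewrite divr_ge0 ?powR_ge0 // addr_ge0 // (hc n).1.
exists (\sum_(n < n0) t n) => [|n s n1 nn0 hb ha]; first exact: sumr_ge0.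
apply: (le_trans ((hc n).2 n1 _ hb.1)); rewrite lee_fin.
have [J [I [hI _ hbias]]] := bias_truncate_ball 0 rad0 hb ha (lexx _).
have : bias s (indices set0) <= B.
  rewrite (_ : set0 = truncate 0 I).
    apply: (le_trans hbias); rewrite lerD2l.
    by rewrite /= expr0 invr1 powR1 mulr1.
  by apply/seteqP; split => // -[j k] [_ /=].
move=> hB; apply: (@le_trans _ _ (t n * x n `^ q)).
  by rewrite divfK ?gt_eqF ?XQ // lerD2r.
rewrite ler_pM2r ?XQ // (bigD1 (Ordinal nn0)) //= lerDl; exact: sumr_ge0.
Qed.

(** The target dimension [M] is of order x^(q - 1), which balances the penalty x M and
    the squared bias M^(- 2 alpha). *)
Lemma risk_large_n rad : 0 < rad -> exists2 r, 0 <= r & forall n s, (n0 <= n)%N ->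
  besov_ball phi psi alpha rad s -> approx_ball phi psi theta alpha rad s ->
  (\int[P]_w (loss s n w)%:E <= (r * x n `^ q)%:E)%E.
Proof.
move=> rad0.
have a0 := alpha_gt0; have q0 := expo_gt0; have q1 := expo_lt1.
have /andP[k1 k2] := kappa'_bounds.
pose C1 := 2 * kappa' / (kappa' - 1).
pose C2 := 1 + (kappa' + 1) / (kappa' * (kappa' - 1)).
have k0 : 0 < kappa' by lra.
have km : 0 < kappa' - 1 by lra.
have C10 : 0 <= C1 by rewrite divr_ge0 ?mulr_ge0 // ltW.
have C20 : 0 <= C2 by rewrite addr_ge0 // divr_ge0 ?addr_ge0 ?mulr_ge0 // ltW.
have Xmax0 : 0 <= Xmax by exact: le_trans (ltW (x_gt0 n0_gt0)) (x_bounded n0_gt0).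
pose d0 : R := (D 0)%:R.
have d01 : 1 <= d0 by rewrite ler1n dimJ_gt0.
pose r := C1 * (C2 * ((2 * rad) ^+ 2 + 2 * rad) + d0 * (2 + Xmax) + 9 * (1 + Xmax)).
exists r => [|n s hn hb ha].
  have d00 : 0 <= d0 by exact: le_trans d01.
  have r2 : 0 <= (2 * rad) ^+ 2 + 2 * rad by rewrite addr_ge0 ?sqr_ge0 // mulr_ge0 // ltW.
  have h1 : 0 <= d0 * (2 + Xmax) by apply: mulr_ge0 => //; apply: addr_ge0.
  have h2 : 0 <= 9 * (1 + Xmax) by apply: mulr_ge0 => //; apply: addr_ge0.
  by apply: mulr_ge0 => //; do 2 apply: addr_ge0 => //; exact: mulr_ge0.
have n1 : (0 < n)%N by exact: leq_trans hn.
have X0 := x_gt0 n1; have XQ : 0 < x n `^ q by exact: powR_gt0.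
have XE : x n = x n `^ q * x n `^ (1 - q).
  by rewrite -powR_pD // addrC subrK powRr1 // ltW.
have XX : x n <= (1 + Xmax) * x n `^ q.
  rewrite {1}XE mulrC ler_pM2r //.
  apply: (@le_trans _ _ ((1 + Xmax) `^ (1 - q))).
    apply: powR_le; rewrite ?subr_ge0 ?(ltW q1) ?(ltW X0) //.
    by rewrite (le_trans (x_bounded n1)) // lerDr.
  apply: (@le_trans _ _ ((1 + Xmax) `^ 1)); last by rewrite powRr1 // addr_ge0.
  by apply: ler_powR; rewrite ?lerDl // gerBl ltW.
pose M := d0 * (1 + x n `^ (q - 1)).
have XM : x n * M <= d0 * (2 + Xmax) * x n `^ q.
  have -> : x n * M = d0 * (x n + x n * x n `^ (q - 1)) by rewrite /M; ring.
  have -> : x n * x n `^ (q - 1) = x n `^ q.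
    rewrite -{1}(powRr1 (ltW X0)) -powR_pD //; congr (_ `^ _); ring.
  rewrite -[leRHS]mulrA ler_pM2l; first by nra.
  exact: lt_le_trans d01.
have DM : (D 0)%:R <= M.
  by rewrite /M -/d0 mulrDr mulr1 lerDl mulr_ge0 ?powR_ge0 // (le_trans _ d01).
have [J [I [hI DJ hbias]]] := bias_truncate_ball (j0 n) rad0 hb ha DM.
have hbias2 : bias s (indices (truncate (j0 n) I)) <= ((2 * rad) ^+ 2 + 2 * rad) * x n `^ q.
  apply: (le_trans hbias); rewrite [leRHS]mulrDl; apply: lerD.
    rewrite exprMn ler_wpM2l ?sqr_ge0 //.
    have hM : x n `^ (q - 1) <= M.
      rewrite /M -[leLHS]mul1r; apply: ler_pM; rewrite ?powR_ge0 // lerDr; exact: ler01.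
    have p0 : 0 < x n `^ (q - 1) by exact: powR_gt0.
    apply: (@le_trans _ _ ((x n `^ (q - 1)) `^ (- alpha) ^+ 2)).
      apply: lerXn2r; rewrite ?nnegrE ?powR_ge0 // !powRN.
      have pM : 0 < M by exact: lt_le_trans hM.
      rewrite lef_pV2 ?posrE ?powR_gt0 //.
      by apply: powR_le; rewrite ?(ltW a0) ?(ltW p0).
    rewrite -powR_mulrn ?powR_ge0 // -!powRrM le_eqVlt; apply/orP; left; apply/eqP.
    by congr (_ `^ _); field; rewrite gt_eqF //; lra.
  have -> : 2 * rad * x n `^ q = rad * (2 * x n `^ q) by ring.
  rewrite ler_pM2l //.
  apply: le_trans (powR_double (ltW X0) _); last by rewrite (ltW q0) (ltW q1).
  apply: powR_le; rewrite ?(ltW q0) ?invr_ge0 ?exprn_ge0 //.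
  by apply: exp2_level_le => //; exact: le_absz_max.
have := oracle_risk eL2 eon theta_gt2 hW hWlin lambda_gt0 hmt n1 hb.1 k1
  (sqrt_lambda_ge2 hn) (entropy_kappa' hn) hI.
move=> h; apply: (le_trans h); rewrite lee_fin -/C1 -/C2 /r -[leRHS]mulrA ler_wpM2l //.
have nR : 0 < n%:R :> R by rewrite ltr0n.
have h4 : 4 * kappa' / n%:R <= 8 * x n.
  rewrite mulrA ler_pM2r ?invr_gt0 //; have := lambda_ge8 hn; lra.
have hpen : x n * (D J)%:R <= d0 * (2 + Xmax) * x n `^ q.
  by apply: le_trans XM; rewrite ler_pM2l.
have hb2 : C2 * bias s (indices (truncate (j0 n) I)) <=
    C2 * ((2 * rad) ^+ 2 + 2 * rad) * x n `^ q.
  by rewrite -[leRHS]mulrA ler_wpM2l.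
rewrite !mulrDl; move: hb2 hpen h4 XX; rewrite !mulrDl; lra.
Qed.

Lemma balls_sub_maxiset rad : 0 < rad -> exists2 r, 0 < r &
  besov_ball phi psi alpha rad `&` approx_ball phi psi theta alpha rad `<=`
  maxiset_ball W (fun n y => shat y (mt n y)) (rate lambda alpha) r.
Proof.
move=> rad0; have [r1 r10 h1] := risk_small_n rad0; have [r2 r20 h2] := risk_large_n rad0.
exists (1 + r1 + r2); first by rewrite -addrA ltr_pwDl // addr_ge0.
move=> s [hb ha]; apply: maxiset_ballI => [|n n1]; first exact: hb.1.
have X0 : 0 < x n `^ q by exact/powR_gt0/x_gt0.
have [hn|hn] := ltnP n n0.
  apply: (le_trans (h1 _ _ n1 hn hb ha)); rewrite lee_fin ler_pM2r //; nra.
apply: (le_trans (h2 _ _ hn hb ha)); rewrite lee_fin ler_pM2r //; nra.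
Qed.

End BallsToMaxiset.

End Maxiset.

(** * The constants of the growth condition *)

Section Constants.
Context {R : realType}.

(** With y the exponent, 1 - delta = (1 - delta)^y (1 - delta)^(1 - y) and the last
    factor is below 1. *)
Lemma gfun_bounds (delta alpha0 : R) : 0 < delta < 1 -> 0 < alpha0 ->
  0 < gfun delta alpha0 <= 1.
Proof.
move=> /andP[d0 d1] a0; rewrite /gfun; set y := 2 * alpha0 / _.
have y0 : 0 < y by apply: divr_gt0; lra.
have y1 : y < 1 by rewrite ltr_pdivrMr; lra.
have b0 : 0 < 1 - delta by lra.
have powlt1 z : 0 < z -> (1 - delta) `^ z < 1.
  move=> z0; apply: (@lt_le_trans _ _ (1 `^ z)); last by rewrite powR1.
  by apply: gt0_ltr_powR; rewrite ?nnegrE; lra.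
have E : 1 - delta = (1 - delta) `^ y * (1 - delta) `^ (1 - y).
  by rewrite -powR_pD // (addrC y) subrK powRr1 // ltW.
have lt1 : (1 - delta) `^ (1 - y) < 1 by apply: powlt1; lra.
have : 1 - delta < (1 - delta) `^ y.
  by rewrite {1}E -[ltRHS]mulr1 ltr_pM2l // powR_gt0.
have := powlt1 _ y0; lra.
Qed.

Lemma Upsilon_ge8 (delta p alpha0 : R) : 0 < delta < 1 -> 0 < p < 1 -> 0 < alpha0 ->
  8 <= Upsilon delta p alpha0.
Proof.
move=> hd /andP[p0 p1] a0; have /andP[g0 g1] := gfun_bounds hd a0.
rewrite /Upsilon; set g := gfun _ _ in g0 g1 *.
have pg : 0 < p * g by exact: mulr_gt0.
have h1 : 8 <= 8 / (p * g).
  by rewrite ler_pdivlMr // ler_piMr // mulr_ile1 // ltW.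
have h2 : 1 <= 16 / g + 1 by rewrite lerDr divr_ge0 // ltW.
by rewrite -[leLHS]mulr1; apply: ler_pM.
Qed.

End Constants.

Set Strict Implicit.
Unset Implicit Arguments.
Set Printing Implicit Defensive.

Theorem proposition6 (R : realType)
  (r : nat) (hr : (1 <= r)%N) (phi psi : R -> R)
  (hwav : wavelet_setting r phi psi)
  (d : measure_display) (T : measurableType d) (P : probability T R)
  (W : (R -> R) -> {RV P >-> R}) (hW : white_noise W)
  (hWlin : {ae P, forall w,
     linear_on (lspan (Psi phi psi @` Psi_indices)) (fun u => W u w)})
  (theta : R) (htheta : 2 < theta)
  (alpha0 alpha : R) (halpha0 : 0 < alpha0) (halpha0r : alpha0 < r%:R)
  (halpha : 0 < alpha) (halphale : alpha <= alpha0)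
  (lambda : nat -> R)
  (hlampos : forall n, (0 < n)%N -> 0 < lambda n)
  (hlammono : forall n m, (0 < n)%N -> (n <= m)%N -> lambda n <= lambda m)
  (hlamlim : (fun n : nat => n%:R^-1 * lambda n) @ \oo --> (0 : R))
  (hlam1 : 1 / 2 < lambda 1%N)
  (j0 : nat -> int)
  (hj0mono : forall n m, (0 < n)%N -> (n <= m)%N -> j0 n <= j0 m)
  (hj0 : forall n, (0 < n)%N ->
     2 ^ j0 n <= n%:R * (lambda n)^-1 < 2 ^ (j0 n + 1))
  (n0 : nat) (delta p kappa : R) (hn0 : (0 < n0)%N)
  (hdelta : 0 < delta <= 1 / 2) (hp : 0 < p < 1) (hkappa : 1 < kappa)
  (hdouble : forall n, (n0 <= n)%N ->
     lambda (2 * n)%N <= 2 * (1 - delta) * lambda n)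
  (hlamn0 : Upsilon delta p alpha0 <= lambda n0)
  (hsum : forall n, (0 < n)%N ->
     (\esum_(m in models_upto phi psi theta (j0 n))
        (expR (- ((Num.sqrt (kappa^-1 * lambda n) - 1) ^+ 2 *
                  (l2dim leb01 m)%:R / 2)))%:E
      <= (Num.sqrt (1 - p))%:E)%E)
  (mt : nat -> ((R -> R) -> R) -> set (R -> R))
  (hmt : selection_rule phi psi theta lambda j0 mt)
  (hmtmeas : forall n s m, (0 < n)%N -> L2 leb01 s ->
     models_upto phi psi theta (j0 n) m ->
     measurable [set w | mt n (data W s n w) = m]) :
  same_balls
    (maxiset_ball W (fun n y => shat y (mt n y)) (rate lambda alpha))
    (fun rad => besov_ball phi psi alpha rad `&`
                approx_ball phi psi theta alpha rad).
Proof.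
have [_ _ _ [eL2 eon _]] := hwav.
have x_small (eps : R) : 0 < eps -> exists N, forall n, (N <= n)%N -> lambda n / n%:R < eps.
  move=> eps0; move/cvgrPdist_lt : hlamlim => /(_ _ eps0)[N _ hN]; exists N => n Nn.
  have := hN n Nn; rewrite /= sub0r normrN mulrC; exact: le_lt_trans (ler_norm _).
have [Xmax hXmax] : exists Xmax, forall n, (0 < n)%N -> lambda n / n%:R <= Xmax.
  have [N hN] := x_small 1 ltr01.
  exists (1 + \sum_(i < N) `|lambda i / i%:R|) => n n1.
  have S0 (Q : pred 'I_N) : 0 <= \sum_(i < N | Q i) `|lambda i / i%:R|.
    by apply: sumr_ge0 => i _; exact: normr_ge0.
  have [nN|Nn] := ltnP n N; last by rewrite (le_trans (ltW (hN _ Nn))) // lerDl.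
  rewrite (bigD1 (Ordinal nN)) //= addrCA (le_trans (ler_norm _)) // lerDl.
  by rewrite addr_ge0.
have /andP[d0 d12] := hdelta.
have d1 : delta < 1 by lra.
have l8 : 8 <= lambda n0.
  by apply: le_trans hlamn0; apply: Upsilon_ge8 => //; rewrite d0.
have entropy n : (0 < n)%N -> (\esum_(m in models_upto phi psi theta (j0 n))
    (expR (- ((Num.sqrt (kappa^-1 * lambda n) - 1) ^+ 2 *
       (l2dim leb01 m)%:R / 2)))%:E <= 1)%E.
  move=> n1; apply: (le_trans (hsum n n1)); rewrite lee_fin -[leRHS]sqrtr1.
  by rewrite ler_wsqrtr //; case/andP: hp => p0 _; rewrite gerBl ltW.
split=> rad rad0.
  exact: (maxiset_sub_balls eL2 eon htheta hWlin hlampos hmt halpha hj0 hn0 d0 d1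
    hdouble hlammono x_small hlam1 hj0mono rad0).
exact: (balls_sub_maxiset eL2 eon htheta hW hWlin hlampos hmt halpha hj0 hn0
  hlammono l8 hkappa entropy hXmax rad0).
Qed.
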